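(* Consider the independent stationary (IID) model set-up with a fixed countable parameter space $\Theta_n=\Theta$, fix $\alpha\ge0$, and let $\pi_n$ be a sequence of discrete priors on $\Theta$ satisfying $$\liminf_{n\to\infty}e^{nr}\,\widetilde\pi_n^{(\alpha)}(\theta)\ge1\quad\text{for all } r>0,\ \theta\in\Theta .$$ Suppose $\pi_n$ is information dense at the true probability mass function (density with respect to $\lambda$) $g$ with respect to $\mathcal F_\alpha=\{\widetilde q^{(\alpha)}(\cdot|\theta):\theta\in\Theta\}$, and that, for a sequence of measurable subsets $A_n\subseteq\Theta$, $\pi_n^{(\alpha)}(A_n^c|\underline X_n)$ is exponentially small with probability one (i.e. there is $r>0$ with $P(\pi_n^{(\alpha)}(A_n^c|\underline X_n)\ge e^{-nr}\text{ infinitely often})=0$). Then any approximate maximum $R^{(\alpha)}$-posterior estimator $\widehat\theta_\alpha$ satisfies $\widehat\theta_\alpha\in A_n$ for all sufficiently large $n$ with probability one.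
   Context: IID set-up with discrete priors. On a true probability space $(\Omega,\mathcal B_\Omega,P)$, $X_1,X_2,\dots$ are i.i.d. with values in a measurable space $(\chi,\mathcal B)$, with law $G$ having density $g$ with respect to a $\sigma$-finite measure $\lambda$; $\underline X_n=(X_1,\dots,X_n)$. The model is $\{F_\theta:\theta\in\Theta\}$ with $\Theta\subseteq\mathbb R^p$ countable and densities $f_\theta$ with respect to $\lambda$. The priors $\pi_n$ are sub-probability mass functions on $\Theta$: $\sum_\theta\pi_n(\theta)\le1$. For $\alpha>0$ let $q_\theta^{(\alpha)}(y)=\frac1\alpha(f_\theta^\alpha(y)-1)-\frac1{1+\alpha}\int f_\theta^{1+\alpha}d\lambda$, and $q_\theta^{(0)}(y)=\log f_\theta(y)-1$; $q_n^{(\alpha)}(\underline x_n|\theta)=\sum_{i=1}^nq_\theta^{(\alpha)}(x_i)$. Put $Q^{(\alpha)}(\chi|\theta)=\int_\chi\exp(q_\theta^{(\alpha)}(y))\lambda(dy)$, $Q_n^{(\alpha)}(\chi^n|\theta)=Q^{(\alpha)}(\chi|\theta)^n$, $M_n^{(\alpha)}(\chi^n,\Theta)=\sum_{\theta\in\Theta}Q_n^{(\alpha)}(\chi^n|\theta)\pi_n(\theta)$, with $0<M_n^{(\alpha)}(\chi^n,\Theta)<\infty$ and $0<Q^{(\alpha)}(\chi|\theta)<\infty$ assumed. The $R^{(\alpha)}$-posterior is $\pi_n^{(\alpha)}(A|\underline x_n)=\sum_{\theta\in A}\exp(q_n^{(\alpha)}(\underline x_n|\theta))\pi_n(\theta)\big/\sum_{\theta\in\Theta}\exp(q_n^{(\alpha)}(\underline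 x_n|\theta))\pi_n(\theta)$. The $\alpha$-modified densities and prior are $\widetilde q^{(\alpha)}(y|\theta)=\exp(q_\theta^{(\alpha)}(y))/Q^{(\alpha)}(\chi|\theta)$, $\widetilde q_n^{(\alpha)}(\underline x_n|\theta)=\prod_{i=1}^n\widetilde q^{(\alpha)}(x_i|\theta)$ and $\widetilde\pi_n^{(\alpha)}(\theta)=Q_n^{(\alpha)}(\chi^n|\theta)\pi_n(\theta)/M_n^{(\alpha)}(\chi^n,\Theta)$. With $KLD(f_1,f_2)=\int f_1\log(f_1/f_2)d\lambda$, $\pi_n$ is information dense at $g$ with respect to $\mathcal F_\alpha$ if there is a finite measure $\widetilde\pi$ on $\Theta$ such that $\liminf_{n\to\infty}e^{nr}\frac{d\widetilde\pi_n^{(\alpha)}}{d\widetilde\pi}(\theta)\ge1$ for all $r>0$, $\theta\in\Theta$, and $\widetilde\pi(\{\theta:KLD(g,\widetilde q^{(\alpha)}(\cdot|\theta))<\epsilon\})>0$ for all $\epsilon>0$. An approximate maximum $R^{(\alpha)}$-posterior estimator is a measurable $\widehat\theta_\alpha=\widehat\theta_\alpha(\underline x_n)\in\Theta$ with $\widetilde\pi_n^{(\alpha)}(\widehat\theta_\alpha)\,\widetilde q_n^{(\alpha)}(\underline x_n|\widehat\theta_\alpha)>\sup_\theta\widetilde\pi_n^{(\alpha)}(\theta)\,\widetilde q_n^{(\alpha)}(\underline x_n|\theta)\,e^{-n\delta_n}$, where $\lim_{n\to\infty}\delta_n=0$ (evaluated at $\underline x_n=\underline X_n$). *)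

(* Defs.v *)
From HB Require Import structures.
From mathcomp Require Import all_boot all_order all_algebra finmap.
From mathcomp Require Import all_classical all_reals all_analysis.
From mathcomp Require Import measurable_realfun.

Set Implicit Arguments.
Unset Strict Implicit.
Unset Printing Implicit Defensive.

Import Order.TTheory GRing.Theory Num.Theory.
Import numFieldNormedType.Exports.

Local Open Scope classical_set_scope.
Local Open Scope ring_scope.
Local Open Scope ereal_scope.

(* The parameter space is a subset of R^p, represented by p.-tuple R with its
   product (= Borel) sigma-algebra; samples of size n live in n.-tuple chi.
   Random variables are indexed from 0, so X_1, ..., X_n are X 0, ..., X n.-1.
   Exponents, densities and sums take values in the extended reals, where
   x / 0 = +oo for 0 < x, x / +oo = 0 and 0 * +oo = 0. *)

Section independence.
Context d dT (R : realType) (Omega : measurableType d) (chi : measurableType dT).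
Variable P : probability Omega R.

Definition mutually_independent (X : nat -> {RV P >-> chi}) :=
  forall (J : {fset nat}) (B : nat -> set chi),
    (forall i, measurable (B i)) ->
    P (\bigcap_(i in [set` J]) (X i @^-1` B i)) =
    \prod_(i <- enum_fset J) P (X i @^-1` B i).

Definition sample (X : nat -> {RV P >-> chi}) (n : nat) (w : Omega)
  : n.-tuple chi := [tuple X i w | i < n].

Definition exponentially_small_as (Y : nat -> Omega -> \bar R) :=
  exists2 r : R, (0 < r)%R &
    P (lim_sup_set (fun n => [set w | (expR (- (n%:R * r)))%:E <= Y n w])) = 0.

End independence.

Section densities.
Context d (R : realType) (T : measurableType d).
Variable mu : {measure set T -> \bar R}.

Definition is_prob_density (f : T -> R) :=
  [/\ measurable_fun setT f, (forall y, 0 <= f y)%R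
    & \int[mu]_y (f y)%:E = 1].

Definition is_density_of (m : set T -> \bar R) (f : T -> R) :=
  [/\ measurable_fun setT f, (forall y, 0 <= f y)%R
    & forall B, measurable B -> m B = \int[mu]_(y in B) (f y)%:E].

(* The integrand is 0 where f1 = 0, and +oo where f2 = 0 < f1. *)
Definition KLD (f1 f2 : T -> \bar R) : \bar R :=
  \int[mu]_y (f1 y * lne (f1 y / f2 y)).

(* h is a version of the Radon-Nikodym derivative d m / d mu on D. *)
Definition is_RN_derivative (D : set T) (m : set T -> \bar R) (h : T -> \bar R) :=
  [/\ measurable_fun D h, (forall t, D t -> 0 <= h t)
    & forall A, measurable A -> A `<=` D -> m A = \int[mu]_(t in A) h t].

End densities.

Section R_posterior.
Context d (R : realType) (p : nat) (chi : measurableType d).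
Variables (lambda : {measure set chi -> \bar R}) (alpha : R).
Variables (Theta : set (p.-tuple R)) (f : p.-tuple R -> chi -> R).
Variable pi : nat -> p.-tuple R -> R.

Definition q (t : p.-tuple R) (y : chi) : \bar R :=
  if alpha == 0%R then lne (f t y)%:E - 1
  else (alpha^-1 * (f t y `^ alpha - 1))%:E
       - ((1 + alpha)^-1)%:E * \int[lambda]_z (f t z `^ (1 + alpha))%:E.

Definition qn (n : nat) (x : n.-tuple chi) (t : p.-tuple R) : \bar R :=
  \sum_(i < n) q t (tnth x i).

Definition Q (t : p.-tuple R) : \bar R := \int[lambda]_y expeR (q t y).

Definition Qn (n : nat) (t : p.-tuple R) : \bar R := Q t ^+ n.

Definition Mn (n : nat) : \bar R := \esum_(t in Theta) (Qn n t * (pi n t)%:E).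

Definition R_posterior (n : nat) (A : set (p.-tuple R)) (x : n.-tuple chi)
  : \bar R :=
  (\esum_(t in A) (expeR (qn x t) * (pi n t)%:E)) /
  (\esum_(t in Theta) (expeR (qn x t) * (pi n t)%:E)).

Definition mod_density (t : p.-tuple R) (y : chi) : \bar R :=
  expeR (q t y) / Q t.

Definition mod_density_n (n : nat) (x : n.-tuple chi) (t : p.-tuple R)
  : \bar R := \prod_(i < n) mod_density t (tnth x i).

Definition mod_prior (n : nat) (t : p.-tuple R) : \bar R :=
  Qn n t * (pi n t)%:E / Mn n.

Definition mod_prior_measure (n : nat) (A : set (p.-tuple R)) : \bar R :=
  \esum_(t in A) mod_prior n t.

Definition is_prior_sequence :=
  forall n, (0 < n)%N ->
    (forall t, Theta t -> (0 <= pi n t)%R) /\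
    \esum_(t in Theta) (pi n t)%:E <= 1.

Definition information_dense (g : chi -> R) :=
  exists nu : {finite_measure set (p.-tuple R) -> \bar R},
    [/\ nu (~` Theta) = 0,
        (exists h : nat -> p.-tuple R -> \bar R,
          (forall n, (0 < n)%N ->
            is_RN_derivative nu Theta (mod_prior_measure n) (h n)) /\
          (forall r : R, (0 < r)%R -> forall t, Theta t ->
            1 <= limn_einf (fun n => (expR (n%:R * r))%:E * h n t)))
      & forall e : R, (0 < e)%R ->
          0 < nu [set t | Theta t /\
                  KLD lambda (fun y => (g y)%:E) (mod_density t) < e%:E]].

End R_posterior.

(* The defining inequality is strict, so it fails wherever the supremum is 0 or
   +oo, and for n = 0; it is required for n >= 1 and almost every sample. *)
Definition approx_max_estimator dO d (R : realType) (p : nat)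
    (Omega : measurableType dO) (chi : measurableType d)
    (P : probability Omega R) (X : nat -> {RV P >-> chi})
    (lambda : {measure set chi -> \bar R}) (alpha : R)
    (Theta : set (p.-tuple R)) (f : p.-tuple R -> chi -> R)
    (pi : nat -> p.-tuple R -> R)
    (that : forall n : nat, n.-tuple chi -> p.-tuple R) :=
  let L n x t := mod_prior lambda alpha Theta f pi n t *
                 @mod_density_n _ R p chi lambda alpha f n x t in
  (forall n, (0 < n)%N -> measurable_fun setT (that n) /\
                          forall x, Theta (that n x)) /\
  exists2 delta : nat -> R, delta @ \oo --> (0 : R)%R &
    forall n, (0 < n)%N -> {ae P, forall w,
      ereal_sup [set L n (sample X n w) t | t in Theta] *
        (expR (- (n%:R * delta n)))%:E
      < L n (sample X n w) (that n (sample X n w))}.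

(* Main.v *)
Require Import Defs.
From HB Require Import structures.
From mathcomp Require Import all_boot all_order all_algebra finmap.
From mathcomp Require Import all_classical all_reals all_analysis.
From mathcomp Require Import measurable_realfun.
From mathcomp Require Import fingroup perm ring lra zify.

Set Implicit Arguments.
Unset Strict Implicit.
Unset Printing Implicit Defensive.

Import Order.TTheory GRing.Theory Num.Theory.
Import numFieldNormedType.Exports.

Local Open Scope classical_set_scope.
Local Open Scope ring_scope.
Local Open Scope ereal_scope.

(* After division by the true likelihood [\prod_i g (X_i)], the mixture
   [\sum_t mod_prior t * \prod_i s_t (X_i)], with [s_t] the modified densities,
   has expectation at most 1, so by Markov and Borel-Cantelli it is eventually at
   most [e^(n eps)].  If some [t0] satisfies
   [\prod_i s_t0 (X_i) >= e^(-n eps) \prod_i g (X_i)], then the maximal term of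
   the mixture is within a factor [e^(-O(n eps))] of the whole sum, so a set whose
   posterior probability is smaller than [e^(-n r)] cannot contain the
   approximate maximizer.
   The strong law of large numbers for [log (g / s_t0)] can be avoided: a
   Pinsker-type inequality shows that the positive part of the log-ratio has small
   mean when [KLD (g, s_t0)] is small, and a maximal inequality for exchangeable
   averages bounds the probability that the lower bound on the likelihood of [t0]
   ever fails.  Letting [KLD (g, s_t0)] tend to 0 makes the exceptional event
   negligible. *)

(** * Independence and exchangeability *)

Section change_of_density.
Context dO d (Omega : measurableType dO) (chi : measurableType d)
  (R : realType).
Variables (mu : {measure set Omega -> \bar R}) (m : {measure set chi -> \bar R}).
Variables (phi : Omega -> chi) (U : Omega -> R) (c : R).
Hypotheses (mphi : measurable_fun setT phi) (mU : measurable_fun setT U).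
Hypothesis U0 : forall w, (0 <= U w)%R.
Hypothesis UB : forall B, measurable B ->
  \int[mu]_w (U w * \1_B (phi w))%:E = c%:E * m B.

Import HBNNSimple.

Let mcomp (k : chi -> R) : measurable_fun setT k ->
  measurable_fun setT (fun w => (U w * k (phi w))%:E).
Proof.
move=> mk; apply/measurable_EFinP; apply: measurable_funM => //.
exact: measurableT_comp.
Qed.

Let integral_simple (s : {nnsfun chi >-> R}) :
  \int[mu]_w (U w * s (phi w))%:E = c%:E * \int[m]_y (s y)%:E.
Proof.
have mk (k : R) : d.-measurable (s @^-1` [set k]).
  by rewrite -[X in measurable X]setTI; exact: measurable_funP.
rewrite integralT_nnsfun sintegralE ge0_mule_fsumr; last first.
  by move=> r; exact: nnsfun_mulemu_ge0.
transitivity (\sum_(k \in range s)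
    \int[mu]_w (U w * (k * \1_(s @^-1` [set k]) (phi w)))%:E).
  rewrite -ge0_integral_fsum//.
  - apply: eq_integral => w _; rewrite fsumEFin//; congr EFin.
    rewrite [in LHS](fimfunE s) !fsbig_finite//=.
    by rewrite mulr_sumr.
  - move=> k; apply: (mcomp (k := fun y => (k * \1_(s @^-1` [set k]) y)%R)).
    exact: measurable_funM.
  - move=> k w _; rewrite lee_fin mulr_ge0//.
    by have := nnfun_muleindic_ge0 s k (phi w); rewrite lee_fin.
apply: eq_fsbigr => k /set_mem[y _ <-].
under eq_integral do rewrite mulrCA EFinM.
rewrite ge0_integralZl_EFin//=.
- by rewrite UB// muleCA.
- by move=> w _; rewrite lee_fin mulr_ge0.
- apply: (mcomp (k := \1_(s @^-1` [set s y]))).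
  exact: measurable_indic.
Qed.

(** By [UB], the image under [phi] of the measure with density [U] is [c] times [m]. The identity
    passes from indicators to simple functions by linearity, then to [h] by monotone convergence.
    Three uses follow: splitting one factor off a product of independent variables, the law of [X i]
    ([U = 1]), and the density [g] ([phi = id]). *)
Lemma integral_change_of_density (h : chi -> \bar R) :
  measurable_fun setT h -> (forall y, 0 <= h y) ->
  \int[mu]_w ((U w)%:E * h (phi w)) = c%:E * \int[m]_y h y.
Proof.
move=> mh h0; pose h_ := nnsfun_approx measurableT mh.
have cvgh y : (h_ n y)%:E @[n --> \oo] --> h y by exact: cvg_nnsfun_approx.
have ndh y : {homo (fun n => (h_ n y)%:E) : n k / (n <= k)%N >-> n <= k}.
  by move=> n k nk; rewrite lee_fin; exact/lefP/nd_nnsfun_approx.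
have -> : \int[m]_y h y = limn (fun n => \int[m]_y (h_ n y)%:E).
  rewrite -monotone_convergence//.
  - by apply: eq_integral => y _; exact/esym/cvg_lim.
  - by move=> n; exact/measurable_EFinP/measurable_funP.
  - by move=> n y _; rewrite lee_fin.
have -> : \int[mu]_w ((U w)%:E * h (phi w)) =
    limn (fun n => \int[mu]_w (U w * h_ n (phi w))%:E).
  rewrite -monotone_convergence//.
  - apply: eq_integral => w _; apply/esym/cvg_lim => //=.
    under eq_fun do rewrite EFinM.
    exact: cvgeZl.
  - by move=> n; apply: mcomp; exact: measurable_funP.
  - by move=> n w _; rewrite lee_fin mulr_ge0.
  - by move=> w _ n k nk; rewrite !EFinM lee_wpmul2l ?lee_fin//; apply/ndh.
under eq_fun do rewrite integral_simple.
apply: limeMl => //; apply: ereal_nondecreasing_is_cvgn => n k nk.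
apply: ge0_le_integral => //.
- by move=> y _; rewrite lee_fin.
- exact/measurable_EFinP/measurable_funP.
- exact/measurable_EFinP/measurable_funP.
- by move=> y _; apply/ndh.
Qed.

End change_of_density.

(** Rectangles are stable under intersection and generate the product sigma-algebra, because a
    cylinder over one coordinate is a rectangle with full other sides. The whole space is itself a
    rectangle, so finiteness of [m1] there is enough for uniqueness. *)
Lemma tuple_measure_unique d (T : measurableType d) (R : realType) n
    (m1 m2 : {measure set n.-tuple T -> \bar R}) :
  m1 setT < +oo ->
  (forall B : 'I_n -> set T, (forall i, measurable (B i)) ->
    m1 [set x | forall i, B i (tnth x i)] =
    m2 [set x | forall i, B i (tnth x i)]) ->
  forall A, measurable A -> m1 A = m2 A.
Proof.
move=> m1oo m12 A mA.
pose rect (B : 'I_n -> set T) := [set x : n.-tuple T | forall i, B i (tnth x i)].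
pose G := [set rect B | B in [set B | forall i, measurable (B i)]].
have mrect B : (forall i, measurable (B i)) -> measurable (rect B).
  move=> mB; have -> : rect B = \bigcap_(i in [set: 'I_n])
      ((fun x : n.-tuple T => tnth x i) @^-1` B i).
    by apply/seteqP; split => x /= H i; [move=> _; exact: H|exact: (H i I)].
  apply: fin_bigcap_measurable => // i _.
  rewrite -[X in measurable X]setTI.
  exact: measurable_tnth.
have GT : G setT.
  by exists (fun=> setT) => //=; apply/seteqP; split.
apply: (measure_unique G (fun=> setT)) => //.
- rewrite eqEsubset; split => [|C]; last first.
    apply: smallest_sub; first exact: sigma_algebra_measurable.
    by move=> _ [B mB <-]; exact: mrect.
  apply: smallest_sub; first exact: smallest_sigma_algebra.
  elim/big_ind : _ => //=.
    by move=> U V UG VG; rewrite subUset.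
  move=> i _ _ [B mB <-]; apply: sub_sigma_algebra.
  exists (fun j => if j == i then B else setT) => /=.
    by move=> j; case: ifP.
  rewrite setTI; apply/seteqP; split => x /=.
    by move=> /(_ i); rewrite eqxx.
  by move=> Bx j; case: eqP => // ->.
- move=> _ _ [B mB <-] [C mC <-]; exists (fun i => B i `&` C i).
    by move=> i; exact: measurableI.
  apply/seteqP; split => x /=.
    by move=> H; split => i; have [] := H i.
  by move=> [H1 H2] i; split.
- by rewrite bigcup_const//; exists 0%N.
- by move=> _ [B mB <-]; exact: m12.
Qed.

(** * Product formulas and permutation invariance for i.i.d. samples *)

Section iid.
Context dO d (R : realType) (Omega : measurableType dO)
  (chi : measurableType d).
Variables (P : probability Omega R) (X : nat -> {RV P >-> chi}).
Variable G : probability chi R.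
Hypotheses (Xindep : mutually_independent X)
  (Xlaw : forall i B, measurable B -> distribution P (X i) B = G B).

(** Independence is stated for finite sets of naturals; here it is applied to the first [n] naturals
    and its product is reindexed by ordinals. The case [n = 0] is separate because [inord] targets a
    nonempty ordinal type. *)
Lemma probability_rectangle n (B : 'I_n -> set chi) :
  (forall i, measurable (B i)) ->
  P (\bigcap_(i in [set: 'I_n]) (X i @^-1` B i)) = \prod_(i < n) G (B i).
Proof.
case: n B => [|n] B mB.
  rewrite big_ord0 (_ : bigcap _ _ = setT) ?probability_setT//.
  by apply/seteqP; split => // w _ [].
pose B' k := B (inord k).
pose J := seq_fset tt (iota 0 n.+1).
have JE k : (k \in J) = (k < n.+1)%N.
  by rewrite seq_fsetE mem_iota add0n.
have := @Xindep J B' (fun i => mB _).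
have -> : \bigcap_(i in [set` J]) (X i @^-1` B' i) =
    \bigcap_(i in [set: 'I_n.+1]) (X i @^-1` B i).
  apply/seteqP; split => w /= H i /=.
    by move=> _; have := H i; rewrite /= JE ltn_ord /B' inord_val; apply.
  by rewrite JE => ni; have := H (Ordinal ni) I; rewrite /B' /=;
    congr (B _ _); apply/val_inj; rewrite /= inordK.
move=> ->; rewrite (perm_big (iota 0 n.+1)); last first.
  by rewrite -[X in perm_eq _ X]undup_id; [exact: seq_fset_perm|exact: iota_uniq].
rewrite -[iota _ _]/(index_iota 0 n.+1) big_mkord.
by apply: eq_bigr => i _; rewrite /B' inord_val; exact: Xlaw.
Qed.

Let measurable_prodX n (h : 'I_n -> chi -> R) (p : pred 'I_n) :
  (forall i, measurable_fun setT (h i)) ->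
  measurable_fun setT (fun w => \prod_(i < n | p i) h i (X i w))%R.
Proof.
move=> mh; under eq_fun do rewrite big_mkcond.
apply: measurable_prod => i _; case: (p i) => //.
exact: measurableT_comp.
Qed.

Lemma expectation_prod n (h : 'I_n -> chi -> R) (e : 'I_n -> R) :
  (forall i, measurable_fun setT (h i)) ->
  (forall i y, (0 <= h i y)%R) ->
  (forall i, \int[G]_y (h i y)%:E = (e i)%:E) ->
  \int[P]_w (\prod_(i < n) h i (X i w))%:E = (\prod_(i < n) e i)%:E.
Proof.
(* Replace the indicator functions by general functions one index at a time. *)
suff step (k : nat) : forall (h : 'I_n -> chi -> R) (e : 'I_n -> R),
    (forall i, measurable_fun setT (h i)) ->
    (forall i y, (0 <= h i y)%R) ->
    (forall i, \int[G]_y (h i y)%:E = (e i)%:E) ->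
    (forall i : 'I_n, (k <= i)%N ->
      exists2 B : set chi, measurable B & h i = \1_B) ->
    \int[P]_w (\prod_(i < n) h i (X i w))%:E = (\prod_(i < n) e i)%:E.
  by move=> mh h0 he; apply: (step n) => // i; rewrite leqNgt ltn_ord.
elim: k => [|k IH] {h}h {e}e mh h0 he hB.
  pose B i := s2val (cid2 (hB i (leq0n _))).
  have mB i : measurable (B i) by rewrite /B; case: cid2.
  have hE i : h i = \1_(B i) by rewrite /B; case: cid2.
  have eE i : (e i)%:E = G (B i).
    by rewrite -he hE integral_indic// setIT.
  rewrite -prodEFin; under [RHS]eq_bigr do rewrite eE.
  rewrite -probability_rectangle// -[X in P X]setIT -integral_indic//; last first.
    apply: fin_bigcap_measurable => // i _.
    by rewrite -[X in measurable X]setTI; exact: measurable_funP.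
  apply: eq_integral => w _; congr EFin.
  under eq_bigr do rewrite hE.
  rewrite [RHS]indicE; have [/set_mem wB|] := boolP (w \in _).
    rewrite big1// => i _; rewrite indicE mem_set//.
    exact: wB.
  move=> wB; have [i wBi] : exists i, ~ B i (X i w).
    apply/not_existsP => H; move/negP: wB; apply; apply/mem_set => i _.
    exact: contrapT (H i).
  by rewrite (bigD1 i)//= indicE memNset// mul0r.
have [nk|kn] := leqP n k.
  by apply: IH => // i ki; have := ltn_ord i; rewrite ltnNge (leq_trans nk ki).
pose i0 := Ordinal kn.
(* With the other factors as weight [U], the induction hypothesis for an indicator at [i0] is
   exactly the hypothesis of the change of density. It then allows an arbitrary [h i0]. *)
have UB B : measurable B ->
    \int[P]_w ((\prod_(i < n | i != i0) h i (X i w)) * \1_B (X i0 w))%:E =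
    (\prod_(i < n | i != i0) e i)%:E * G B.
  move=> mB.
  pose h' i := if i == i0 then \1_B : chi -> R else h i.
  pose e' i := if i == i0 then fine (G B) else e i.
  transitivity (\int[P]_w (\prod_(i < n) h' i (X i w))%:E).
    apply: eq_integral => w _; congr EFin.
    rewrite [RHS](bigD1 i0)//= mulrC /h' eqxx; congr (_ * _)%R.
    by apply: eq_bigr => i /negbTE ->.
  rewrite (IH h' e').
  - rewrite (bigD1 i0)//= /e' eqxx EFinM fineK ?fin_num_measure// muleC.
    congr (_%:E * _).
    by apply: eq_bigr => i /negbTE ->.
  - by move=> i; rewrite /h'; case: ifP => // _; exact: measurable_indic.
  - by move=> i y; rewrite /h'; case: ifP.
  - move=> i; rewrite /h' /e'; case: ifP => // _.
    by rewrite integral_indic// setIT fineK ?fin_num_measure.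
  - move=> i ki; rewrite /h'; case: eqP => [_|/eqP ii0]; first by exists B.
    apply: hB; rewrite ltn_neqAle ki andbT.
    by apply: contra ii0 => /eqP ki'; apply/eqP/val_inj.
under eq_integral => w _.
  rewrite (bigD1 i0)//= mulrC EFinM.
  over.
rewrite (integral_change_of_density (m := G) _ _ _ UB
  (h := fun y => (h i0 y)%:E)) //.
- by rewrite he -EFinM [in RHS](bigD1 i0)//= mulrC.
- exact: measurable_prodX.
- by move=> w; apply: prodr_ge0.
- exact/measurable_EFinP.
- by move=> y; rewrite lee_fin.
Qed.

Lemma measurable_sample n : measurable_fun setT (sample X n).
Proof.
apply/measurable_fun_tnthP => i.
rewrite (_ : _ \o _ = X i); first exact: measurable_funP.
by apply/funext => w /=; rewrite tnth_mktuple.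
Qed.

(** The sample and the permuted sample have the same law. Since [D] is invariant under [s], the
    permutation changes only the coordinate in the integrand, not the event. *)
Lemma sample_exchangeable n (s : 'S_n) (D : set (n.-tuple chi)) (i : 'I_n)
    (h : chi -> \bar R) :
  measurable D -> measurable_fun setT h -> (forall y, 0 <= h y) ->
  (forall w, D [tuple X (s j) w | j < n] <-> D (sample X n w)) ->
  \int[P]_(w in sample X n @^-1` D) h (X i w) =
  \int[P]_(w in sample X n @^-1` D) h (X (s i) w).
Proof.
move=> mD mh h0 Ds.
pose Y w := [tuple X (s j) w | j < n].
have mY : measurable_fun setT Y.
  apply/measurable_fun_tnthP => j.
  rewrite (_ : _ \o _ = X (s j)); first exact: measurable_funP.
  by apply/funext => w /=; rewrite tnth_mktuple.
have mX := @measurable_sample n.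
pose mX_ : {mfun Omega >-> n.-tuple chi} :=
  HB.pack (sample X n) (isMeasurableFun.Build _ _ _ _ _ mX).
pose mY_ : {mfun Omega >-> n.-tuple chi} :=
  HB.pack Y (isMeasurableFun.Build _ _ _ _ _ mY).
have eqlaw A : measurable A -> pushforward P mX_ A = pushforward P mY_ A.
  apply: tuple_measure_unique.
    by change (P setT < +oo); rewrite probability_setT ltry.
  move=> B mB.
  rewrite /pushforward.
  transitivity (P (\bigcap_(j in [set: 'I_n]) (X j @^-1` B j))).
    congr (P _); apply/seteqP; split => w /= H j.
      by move=> _; have := H j; rewrite tnth_mktuple.
    by rewrite tnth_mktuple; exact: (H j I).
  (* The condition [X (s j) \in B j] for all [j] puts the side [B (s^-1 j)] on [X j]; the product of
     [G]-probabilities is only reordered. *)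
  transitivity (P (\bigcap_(j in [set: 'I_n]) (X j @^-1` B ((s^-1)%g j)))).
    rewrite !probability_rectangle//.
    by rewrite (reindex_perm s^-1%g).
  congr (P _); apply/seteqP; split => w /= H j.
    by rewrite tnth_mktuple; have := H (s j) I; rewrite permK.
  by move=> _; have := H ((s^-1)%g j); rewrite tnth_mktuple permKV.
have mhi : measurable_fun D (fun x : n.-tuple chi => h (tnth x i)).
  apply: measurable_funTS; apply: measurableT_comp => //.
  exact: measurable_tnth.
transitivity (\int[pushforward P mX_]_(x in D) h (tnth x i)).
  rewrite ge0_integral_pushforward//=.
  by apply: eq_integral => w _ /=; rewrite tnth_mktuple.
transitivity (\int[pushforward P mY_]_(x in D) h (tnth x i)).
  by apply: eq_measure_integral => A mA _; exact: eqlaw.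
rewrite ge0_integral_pushforward//=.
rewrite (_ : Y @^-1` D = sample X n @^-1` D); last first.
  by apply/seteqP; split => w /=; rewrite Ds.
by apply: eq_integral => w _ /=; rewrite tnth_mktuple.
Qed.

Lemma expectation_law i (h : chi -> \bar R) :
  measurable_fun setT h -> (forall y, 0 <= h y) ->
  \int[P]_w h (X i w) = \int[G]_y h y.
Proof.
move=> mh h0; rewrite -[RHS]mul1e.
rewrite -(integral_change_of_density (mu := P) (phi := X i) (U := cst 1%R))//.
  by apply: eq_integral => w _; rewrite mul1e.
move=> B mB; under eq_integral do rewrite mul1r.
have mXB : measurable (X i @^-1` B).
  by rewrite -[X in measurable X]setTI; exact: measurable_funP.
rewrite mul1e -[RHS](Xlaw i mB).
by rewrite -[RHS]/(P (X i @^-1` B)) -[X in P X]setIT -integral_indic.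
Qed.

End iid.

(** * A maximal inequality for averages of i.i.d. nonnegative variables *)

Section maximal_inequality.
Context dO d (R : realType) (Omega : measurableType dO)
  (chi : measurableType d).
Variables (P : probability Omega R) (X : nat -> {RV P >-> chi}).
Variable G : probability chi R.
Hypotheses (Xindep : mutually_independent X)
  (Xlaw : forall i B, measurable B -> distribution P (X i) B = G B).
Variables (h : chi -> \bar R) (c : R).
Hypotheses (mh : measurable_fun setT h) (h0 : forall y, 0 <= h y).
Hypothesis c0 : (0 < c)%R.

Let exceed n := [set w | (n%:R * c)%:E < \sum_(i < n) h (X i w)].

Let measurable_hX i : measurable_fun setT (fun w => h (X i w)).
Proof. by apply: measurableT_comp => //; exact: measurable_funP. Qed.

Let measurable_exceed n : measurable (exceed n).
Proof.
rewrite -[X in measurable X]setTI; apply: emeasurable_fun_o_infty => //.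
exact: emeasurable_sum.
Qed.

Section finite_horizon.
Variable N : nat.

Let S m (x : N.+1.-tuple chi) := \sum_(i < N.+1 | (i < m)%N) h (tnth x i).

Let A m := [set x | (m%:R * c)%:E < S m x].

Let E k := \bigcup_(m in [set m | (N.+1 - k < m <= N.+1)%N]) A m.

(** Times are counted backwards from the horizon: on [D k], the last time at which the average
    exceeds [c] is [N.+1 - k]. These events are disjoint, and [E k.+1] is the union of [D k] and
    [E k]. *)
Let D k := A (N.+1 - k)%N `\` E k.

Let mS m : measurable_fun setT (S m).
Proof.
rewrite /S; under eq_fun do rewrite big_mkcond.
apply: emeasurable_sum => i; case: (i < m)%N => //.
by apply: measurableT_comp => //; exact: measurable_tnth.
Qed.

Let mA m : measurable (A m).
Proof.
rewrite -[X in measurable X]setTI; exact: emeasurable_fun_o_infty.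
Qed.

Let mE k : measurable (E k).
Proof. by apply: bigcup_measurable => m _. Qed.

Let mD k : measurable (D k).
Proof. exact: measurableD. Qed.

Let msample (B : set (N.+1.-tuple chi)) : measurable B ->
  measurable (sample X N.+1 @^-1` B).
Proof.
by move=> mB; rewrite -[X in measurable X]setTI; exact: measurable_sample.
Qed.

Let S_sample m w : (m <= N.+1)%N ->
  S m (sample X N.+1 w) = \sum_(i < m) h (X i w).
Proof.
move=> mN; rewrite /S (big_ord_widen N.+1 (fun i => h (X i w)))//.
by apply: eq_bigr => i _; rewrite tnth_mktuple.
Qed.

Let S_tperm n m w (i : 'I_N.+1) : (i < n)%N -> (n <= m)%N ->
  S m [tuple X (tperm ord0 i j) w | j < N.+1] = S m (sample X N.+1 w).
Proof.
move=> ni nm; rewrite /S [RHS](reindex_perm (tperm ord0 i)) /=.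
apply: eq_big => [j|j _]; last by rewrite !tnth_mktuple.
case: tpermP => [->|->|//] /=; apply/idP/idP => _.
- exact: leq_trans nm.
- exact: leq_ltn_trans (leq0n _) (leq_trans ni nm).
- exact: leq_ltn_trans (leq0n _) (leq_trans ni nm).
- exact: leq_trans nm.
Qed.

(** [D k] involves only the sums [S m] with [m >= N.+1 - k], and each of them contains both swapped
    coordinates. This symmetry is the reason for splitting by the last time of exceedance and not by
    the first. *)
Let D_tperm k w (i : 'I_N.+1) : (i < N.+1 - k)%N ->
  D k [tuple X (tperm ord0 i j) w | j < N.+1] <-> D k (sample X N.+1 w).
Proof.
move=> ik; set x := [tuple _ | _ < _]; set y := sample _ _ _.
have Am m : (N.+1 - k <= m)%N -> A m x <-> A m y.
  by move=> km; rewrite /A /= (S_tperm _ ik km).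
have Ek : E k x <-> E k y.
  by split=> -[m /= mk Ax]; exists m => //; apply/(Am m) => //;
    case/andP: mk => /ltnW.
by split=> -[H1 H2]; split; [exact/(Am _ (leqnn _))|by move/Ek|
  exact/(Am _ (leqnn _))|by move/Ek].
Qed.

(** On [D k] the sum of the first [n = N.+1 - k] terms exceeds [n * c]. By exchangeability these [n]
    terms have the same integral over [D k] as [h (X 0)], and dividing by [n] gives the bound. *)
Let last_exceed k : (k < N.+1)%N ->
  c%:E * P (sample X N.+1 @^-1` D k) <=
  \int[P]_(w in sample X N.+1 @^-1` D k) h (X 0%N w).
Proof.
move=> kN; set n := (N.+1 - k)%N; set F := _ @^-1` _.
have mF : measurable F by exact: msample.
have n0 : (0 < n)%N by rewrite subn_gt0.
have mhX i : measurable_fun F (fun w => h (X i w)).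
  exact: measurable_funTS.
rewrite -(@lee_pmul2l _ n%:R%:E) ?lte_fin ?ltr0n//.
rewrite muleA -EFinM -integral_cst//.
have -> : n%:R%:E * \int[P]_(w in F) h (X 0%N w) =
    \int[P]_(w in F) \sum_(i < n) h (X i w).
  rewrite ge0_integral_sum// -[RHS]/(\sum_(i < n) _).
  rewrite (eq_bigr (fun=> \int[P]_(w in F) h (X 0%N w))).
    by rewrite sumr_const card_ord mule_natl.
  move=> i _; have iN : (i < N.+1)%N.
    by rewrite (leq_trans (ltn_ord i))// leq_subr.
  have := sample_exchangeable Xindep Xlaw (Ordinal iN) (mD k) mh h0
    (s := tperm ord0 (Ordinal iN)).
  rewrite tpermR => ->//.
  by move=> w; apply: D_tperm => /=; exact: (ltn_ord i).
apply: ge0_le_integral => //.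
- by move=> w _; rewrite lee_fin mulr_ge0// ltW.
- exact: emeasurable_sum.
- by move=> w [+ _] => /ltW; rewrite S_sample ?leq_subr.
Qed.

Let exceed_after k : (k <= N.+1)%N ->
  c%:E * P (sample X N.+1 @^-1` E k) <=
  \int[P]_(w in sample X N.+1 @^-1` E k) h (X 0%N w).
Proof.
elim: k => [_|k IH kN].
  rewrite (_ : E 0%N = set0) ?preimage_set0 ?measure0 ?mule0 ?integral_ge0//.
  rewrite /E bigcup0// => m /= /andP[]; rewrite subn0 => Nm mN.
  by move: (leq_trans Nm mN); rewrite ltnn.
have -> : E k.+1 = D k `|` E k.
  rewrite /D setUDl setDv setD0 /E; apply/seteqP; split => x /=.
    move=> [m /= /andP[km mN] Am].
    have [mk|mk] := leqP m (N.+1 - k); last by right; exists m => //=; rewrite mk.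
    by left; rewrite (_ : (N.+1 - k)%N = m)//; lia.
  case => [Ax|[m /= /andP[km mN] Am]].
    by exists (N.+1 - k)%N => //=; lia.
  by exists m => //=; lia.
have DE0 : [disjoint (sample X N.+1 @^-1` D k) & (sample X N.+1 @^-1` E k)].
  by apply/disj_setPRL => w Ew [_ /(_ Ew)].
rewrite preimage_setU measureU//; [|exact: msample|exact: msample|]; last first.
  exact/disj_set2P.
rewrite ge0_integral_setU//; first last.
- exact: measurable_funTS.
- exact: msample.
- exact: msample.
by rewrite ge0_muleDr// leeD// ?IH ?last_exceed// ltnW.
Qed.

Lemma maximal_inequality_finite :
  c%:E * P (\bigcup_(n in [set n | (0 < n <= N.+1)%N]) exceed n) <=
  \int[G]_y h y.
Proof.
have -> : \bigcup_(n in [set n | (0 < n <= N.+1)%N]) exceed n =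
    sample X N.+1 @^-1` E N.+1.
  rewrite /E subnn preimage_bigcup; apply: eq_bigcupr => m /= /andP[_ mN].
  by apply/seteqP; split => w; rewrite /exceed /A /= S_sample.
rewrite (le_trans (exceed_after (leqnn _)))//.
rewrite -(expectation_law Xlaw 0 mh h0).
by apply: ge0_subset_integral => //; exact: msample.
Qed.

End finite_horizon.

(* A weak-type (1,1) bound for the averages of an exchangeable sequence: split
   according to the last time at which the average exceeds [c]. *)
Lemma maximal_inequality :
  c%:E * P (\bigcup_(n in [set n | (0 < n)%N]) exceed n) <= \int[G]_y h y.
Proof.
pose F N := \bigcup_(n in [set n | (0 < n <= N.+1)%N]) exceed n.
have mF N : measurable (F N) by exact: bigcup_measurable.
have -> : \bigcup_(n in [set n | (0 < n)%N]) exceed n = \bigcup_N F N.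
  apply/seteqP; split => [w [n /= n0 nw]|w [N _ [n /= /andP[n0 _] nw]]].
    by exists n => //; exists n => //=; rewrite n0 leqnSn.
  by exists n.
have cvgF : c%:E * P (F N) @[N --> \oo] --> c%:E * P (\bigcup_N F N).
  apply: cvgeZl => //; apply: nondecreasing_cvg_mu => //.
  - exact: bigcupT_measurable.
  - move=> m n mn; apply/subsetPset => w [k /= /andP[k0 km] kw].
    by exists k => //=; rewrite k0 (leq_trans km).
rewrite -(cvg_lim _ cvgF)//; apply: lime_le.
  by apply/cvg_ex; eexists; exact: cvgF.
by apply: nearW => N; exact: maximal_inequality_finite.
Qed.

End maximal_inequality.

(** * Relative entropy *)

Section measurability.
Context d (T : measurableType d) (R : realType).

Lemma measurable_lne_EFin (f : T -> R) : measurable_fun setT f ->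
  measurable_fun setT (fun y => lne (f y)%:E).
Proof.
move=> mf; rewrite /lne; apply: measurable_fun_ifT => //.
  exact: measurable_fun_ler.
by apply/measurable_EFinP; exact: measurableT_comp.
Qed.

Lemma measurable_fun_divr (f s : T -> R) : (forall y, (0 <= s y)%R) ->
  measurable_fun setT f -> measurable_fun setT s ->
  measurable_fun setT (fun y => f y / s y)%R.
Proof.
move=> s0 mf ms.
(* For nonnegative reals the inverse is the power [-1], also at 0, where both are 0. *)
under eq_fun do rewrite -powR_inv1//.
apply: measurable_funM => //.
by apply: (measurableT_comp (measurable_powR (-1))).
Qed.

End measurability.

Section relative_entropy.
Context d (T : measurableType d) (R : realType).
Variables (lambda : {measure set T -> \bar R}) (g s : T -> R).
Hypotheses (mg : measurable_fun setT g) (g0 : forall y, (0 <= g y)%R).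
Hypotheses (ms : measurable_fun setT s) (s0 : forall y, (0 <= s y)%R).

(* [-oo] where [g y = 0], since then [0 / 0 = 0 * +oo = 0]. *)
Definition log_ratio y : \bar R := lne ((g y)%:E / (s y)%:E).

Lemma log_ratioE y : log_ratio y =
  if s y == 0%R then (if g y == 0%R then -oo else +oo)
  else lne (g y / s y)%:E.
Proof.
rewrite /log_ratio; case: ifPn => [/eqP ->|sy0]; last first.
  by rewrite inver (negbTE sy0).
rewrite inver eqxx; case: ifPn => [/eqP ->|gy0]; first by rewrite mul0e /= lexx.
by rewrite gt0_muley// lte_fin lt_neqAle eq_sym gy0 g0.
Qed.

Lemma measurable_log_ratio : measurable_fun setT log_ratio.
Proof.
rewrite (_ : log_ratio = fun y =>
  if s y == 0%R then (if g y == 0%R then -oo else +oo)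
  else lne (g y / s y)%:E); last by apply/funext => y; rewrite log_ratioE.
apply: measurable_fun_ifT; first exact: measurable_fun_eqr.
- by apply: measurable_fun_ifT => //; exact: measurable_fun_eqr.
- by apply: measurable_lne_EFin; exact: measurable_fun_divr.
Qed.

Let psi y := (g y)%:E * log_ratio y.

Let measurable_psi : measurable_fun setT psi.
Proof.
by apply: emeasurable_funM; [exact/measurable_EFinP|exact: measurable_log_ratio].
Qed.

(** Isolates the conventions at zero densities. In the regular case, with [v = ln (g / s)], one has
    [s = g * expR (- v)], so the bounds below reduce to inequalities for the exponential. *)
Let psi_cases y : [\/ g y = 0%R /\ psi y = 0, s y = 0%R /\ psi y = +oo |
  [/\ (0 < g y)%R, s y = (g y * expR (- ln (g y / s y)))%R &
      psi y = (g y * ln (g y / s y))%:E]].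
Proof.
have [gy0|gy0] := eqVneq (g y) 0%R.
  by constructor 1; rewrite /psi gy0 mul0e.
have gy : (0 < g y)%R by rewrite lt_neqAle eq_sym gy0 g0.
have [sy0|sy0] := eqVneq (s y) 0%R.
  by constructor 2; rewrite /psi log_ratioE sy0 eqxx (negbTE gy0) gt0_muley.
have sy : (0 < s y)%R by rewrite lt_neqAle eq_sym sy0 s0.
constructor 3; split => //.
  rewrite expRN lnK ?posrE ?divr_gt0// invf_div mulrCA divff ?mulr1//.
by rewrite /psi log_ratioE (negbTE sy0) lne_EFin ?divr_gt0// -EFinM.
Qed.

(** The left side is [(1 + x / 2) ^+ 2], and [expR x] is the square of
    [expR (x / 2) >= 1 + x / 2]. *)
Let expR_ge_quadratic (x : R) : (0 <= x -> 1 + x + x ^+ 2 / 4 <= expR x)%R.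
Proof.
move=> x0; rewrite [in leRHS](_ : x = x / 2 + x / 2)%R; last by field.
have := expR_ge1Dx (x / 2)%R; rewrite expRD => h.
have : ((1 + x / 2) * (1 + x / 2) <= expR (x / 2) * expR (x / 2))%R.
  by rewrite ler_pM//; lra.
by apply: le_trans; lra.
Qed.

(** In the regular case [- v <= expR (- v)], multiplied by [g]. The negative part of the divergence
    integrand therefore has integral at most that of [s], and the divergence is never of the form
    [+oo - oo]. *)
Let psi_neg_le y : psi^\- y <= (s y)%:E.
Proof.
rewrite funenegE; have [[gy ->]|[sy ->]|[gy sE ->]] := psi_cases y.
- by rewrite oppe0 maxxx lee_fin.
- by rewrite /= maxNye lee_fin.
- rewrite ge_max; apply/andP; split; rewrite -?EFinN lee_fin//.
  set v := ln _ in sE *; rewrite sE.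
  have := expR_ge1Dx (- v)%R => h.
  rewrite -mulrN ler_pM2l//; lra.
Qed.

(* From [e^x >= 1 + x + x^2 / 4] and [2 eta x <= 4 eta^2 + x^2 / 4] at
   [x = log (s / g)]. *)
Let psi_neg_quadratic (eta : R) y : (0 <= eta)%R ->
  (1 + 2 * eta)%:E * psi^\- y + (g y)%:E <=
  (4 * eta ^+ 2)%:E * (g y)%:E + ((s y)%:E + psi^\+ y).
Proof.
move=> eta0; rewrite funenegE funeposE.
have [[gy ->]|[sy ->]|[gy sE ->]] := psi_cases y.
- rewrite oppe0 maxxx gy !mule0 !add0e adde0 lee_fin//.
- by rewrite [maxe +oo _]maxye /= !addey// leey.
- set v := ln _ in sE *.
  rewrite -EFinN -!EFin_max -!EFinM -!EFinD lee_fin [X in (_ <= _ + (X + _))%R]sE.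
  have [v0|v0] := leP 0%R v.
    rewrite max_r; last by rewrite oppr_le0 mulr_ge0// ltW.
    rewrite max_l; last by rewrite mulr_ge0// ltW.
    have h := expR_ge1Dx (- v)%R.
    have : (g y * (1 + - v) <= g y * expR (- v))%R by rewrite ler_pM2l.
    have : (0 <= 4 * eta ^+ 2 * g y)%R by rewrite !mulr_ge0 ?sqr_ge0// ltW.
    lra.
  have w0 : (0 <= - v)%R by lra.
  rewrite max_l; last by rewrite -mulrN mulr_ge0// ltW.
  rewrite max_r; last by rewrite -oppr_ge0 -mulrN mulr_ge0// ltW.
  have h := expR_ge_quadratic w0; set e := expR _ in h *.
  set u := (- v)%R in h w0 *.
  have : (g y * ((1 + 2 * eta) * u + 1) <= g y * (4 * eta ^+ 2 + e))%R.
    rewrite ler_pM2l//.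
    have : (0 <= (2 * eta - u / 2) ^+ 2)%R by exact: sqr_ge0.
    by rewrite sqrrB; nra.
  by rewrite -mulrN -/u; lra.
Qed.

(** Let [a] and [b] be the integrals of the negative and positive parts of [psi], so that
    [b - a < eta^2]. Integrating the pointwise bound gives [2 eta a <= 4 eta^2 + b - a < 5 eta^2].
    Hence [a < 5 eta / 2], and [b < a + eta^2 < 4 eta] because [eta <= 1]. *)
Lemma KLD_log_ratio_pos (eta : R) : (0 < eta <= 1)%R ->
  \int[lambda]_y (g y)%:E = 1 -> \int[lambda]_y (s y)%:E <= 1 ->
  KLD lambda (fun y => (g y)%:E) (fun y => (s y)%:E) < (eta ^+ 2)%:E ->
  \int[lambda]_y ((g y)%:E * maxe 0 (log_ratio y)) <= (4 * eta)%:E.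
Proof.
move=> /andP[eta0 eta1] g1 s1 Klt.
have mneg := measurable_funeneg measurable_psi.
have mpos := measurable_funepos measurable_psi.
have mgE : measurable_fun setT (EFin \o g) by exact/measurable_EFinP.
have msE : measurable_fun setT (EFin \o s) by exact/measurable_EFinP.
have -> : \int[lambda]_y ((g y)%:E * maxe 0 (log_ratio y)) =
    \int[lambda]_y psi^\+ y.
  apply: eq_integral => y _; rewrite funeposE /psi maxC.
  by rewrite maxe_pMr ?lee_fin// mule0.
move: Klt; rewrite /KLD -/(integral _ _ psi) (integralE _ _ psi).
set a := integral _ _ psi^\-; set b := integral _ _ psi^\+.
have a0 : 0 <= a by apply: integral_ge0 => y _; exact: funeneg_ge0.
have b0 : 0 <= b by apply: integral_ge0 => y _; exact: funepos_ge0.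
have a1 : a <= 1.
  apply: le_trans s1; apply: ge0_le_integral => //.
have abE : (1 + 2 * eta)%:E * a + 1 <= (4 * eta ^+ 2)%:E + (1 + b).
  have : \int[lambda]_y ((1 + 2 * eta)%:E * psi^\- y + (g y)%:E) <=
    \int[lambda]_y ((4 * eta ^+ 2)%:E * (g y)%:E + ((s y)%:E + psi^\+ y)).
    apply: ge0_le_integral => //.
    - move=> y _; rewrite adde_ge0 ?mule_ge0 ?lee_fin//; lra.
    - by apply: emeasurable_funD => //; exact: measurable_funeM.
    - apply: emeasurable_funD; first exact: measurable_funeM.
      exact: emeasurable_funD.
    - by move=> y _; apply: psi_neg_quadratic; exact: ltW.
  rewrite !ge0_integralD//; first last.
  - by move=> y _; rewrite lee_fin.
  - exact: measurable_funeM.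
  - by move=> y _; rewrite mule_ge0 ?lee_fin//; lra.
  - exact: emeasurable_funD.
  - by move=> y _; rewrite adde_ge0// lee_fin.
  - exact: measurable_funeM.
  - by move=> y _; rewrite mule_ge0 ?lee_fin// mulr_ge0 ?sqr_ge0.
  - by move=> y _; rewrite lee_fin.
  rewrite !ge0_integralZl_EFin//; first last.
  - lra.
  - by rewrite mulr_ge0 ?sqr_ge0.
  - by move=> y _; rewrite lee_fin.
  rewrite g1 mule1 => /le_trans; apply.
  by rewrite leeD2l// leeD2r.
have : a \is a fin_num by rewrite ge0_fin_numE// (le_lt_trans a1)// ltry.
move: a a0 a1 abE => [a| |]// a0 a1 abE _.
case: b b0 abE => [b| |]// b0.
rewrite -!EFinM -!EFinD !lee_fin => abE.
rewrite lte_fin => ab.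
nra.
Qed.

End relative_entropy.

(** * Modified densities and priors *)

Section countable_esum.
Context (R : realType) (T : choiceType).
Variable D : set T.
Hypothesis countD : countable D.

(** A single enumeration turns the sums of all nonnegative families over [D] into series, so that
    the results on series apply to families depending on [w]. The value [None] marks the naturals
    that code no element; they contribute 0. *)
Let code : {e : nat -> option T | (forall i t, e i = Some t -> D t) /\
  forall a : T -> \bar R, (forall t, D t -> 0 <= a t) ->
    \esum_(t in D) a t = \sum_(i <oo) (if e i is Some t then a t else 0)}.
Proof.
apply: cid; have /countable_injP[f finj] := countD.
have [D0|/set0P[t0 Dt0]] := eqVneq D set0.
  exists (fun=> None); split=> // a _.
  by rewrite D0 esum_set0 eseries0.
pose P i := `[< exists2 t, D t & f t = i >].
pose g i := if pselect (exists2 t, D t & f t = i) is left h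
  then s2val (cid2 h) else t0.
have gP i : P i -> D (g i) /\ f (g i) = i.
  by rewrite /g => /asboolP; case: pselect => // h _; case: cid2.
have gf t : D t -> g (f t) = t.
  move=> Dt; have Pft : P (f t) by apply/asboolP; exists t.
  have [Dg fg] := gP _ Pft.
  by apply: finj => //; apply/mem_set.
exists (fun i => if P i then Some (g i) else None); split.
  by move=> i t; case: ifPn => // /gP[? _] [<-].
move=> a a0.
have imgD : [set g i | i in P] = D.
  apply/seteqP; split => [_ [i /gP[? _] <-] //|t Dt].
  by exists (f t); [apply/asboolP; exists t|exact: gf].
rewrite -[in LHS]imgD esum_pred_image.
- by rewrite eseries_mkcond; apply: eq_eseriesr => i _; case: ifP.
- by move=> i /gP[? _]; exact: a0.
- move=> i j /set_mem Pi /set_mem Pj gij.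
  by rewrite -(gP i Pi).2 -(gP j Pj).2 gij.
Qed.

Let e := sval code.

Let eD i t : e i = Some t -> D t. Proof. exact: (svalP code).1. Qed.

Let eE (a : T -> \bar R) : (forall t, D t -> 0 <= a t) ->
  \esum_(t in D) a t = \sum_(i <oo) (if e i is Some t then a t else 0).
Proof. exact: (svalP code).2. Qed.

Lemma countable_esumZl (r : R) (a : T -> \bar R) : (0 <= r)%R ->
  (forall t, D t -> 0 <= a t) ->
  \esum_(t in D) (r%:E * a t) = r%:E * \esum_(t in D) a t.
Proof.
move=> r0 a0; rewrite !eE//; last first.
  by move=> t Dt; rewrite mule_ge0 ?a0.
rewrite -nneseriesZl//.
  by apply: eq_eseriesr => i _; case: (e i) => //; rewrite mule0.
by move=> i _; case ei: (e i) => [t|//]; exact/a0/(eD ei).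
Qed.

Variables (d : measure_display) (Omega : measurableType d).
Variable a : T -> Omega -> \bar R.
Hypotheses (ma : forall t, D t -> measurable_fun setT (a t))
  (a0 : forall t w, D t -> 0 <= a t w).

Let mterm i : measurable_fun setT
  (fun w => if e i is Some t then a t w else 0).
Proof. by case ei: (e i) => [t|//]; exact/ma/(eD ei). Qed.

Let term_ge0 i w : 0 <= (if e i is Some t then a t w else 0).
Proof. by case ei: (e i) => [t|//]; exact/a0/(eD ei). Qed.

Let aE w : \esum_(t in D) a t w =
  \sum_(i <oo) (if e i is Some t then a t w else 0).
Proof. by apply: eE => t Dt; exact: a0. Qed.

Lemma measurable_countable_esum :
  measurable_fun setT (fun w => \esum_(t in D) a t w).
Proof.
under eq_fun do rewrite aE.
apply: (ge0_emeasurable_sum (P := xpredT)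
  (h := fun i w => if e i is Some t then a t w else 0)) => [i w _ _|i _].
- exact: term_ge0.
- exact: mterm.
Qed.

Lemma integral_countable_esum (mu : {measure set Omega -> \bar R}) :
  \int[mu]_w (\esum_(t in D) a t w) =
  \esum_(t in D) (\int[mu]_w a t w).
Proof.
rewrite [RHS]eE; last by move=> t Dt; apply: integral_ge0 => w _; exact: a0.
under eq_integral do rewrite aE.
rewrite integral_nneseries//.
apply: eq_eseriesr => i _; case: (e i) => //; exact: integral0.
Qed.

End countable_esum.

(** * Modified densities as real probability densities *)

Section model.
Context d (R : realType) (p : nat) (chi : measurableType d).
Variables (lambda : {measure set chi -> \bar R}) (alpha : R).
Hypothesis alpha_ge0 : (0 <= alpha)%R.
Variable f : p.-tuple R -> chi -> R.
Variable t : p.-tuple R.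
Hypothesis ft : is_prob_density lambda (f t).
Hypothesis Qt : 0 < Q lambda alpha f t < +oo.

(** For [alpha = 0] the function is [f t] divided by [e]. Otherwise the term subtracted in [q] is
    nonnegative, so the exponential of its opposite is real even if the integral is [+oo]. *)
Let expeR_q_real : exists k : chi -> R, [/\ measurable_fun setT k,
  (forall y, 0 <= k y)%R & forall y, expeR (q lambda alpha f t y) = (k y)%:E].
Proof.
have [mf f0 _] := ft; have [alpha0|alpha0] := eqVneq alpha 0%R.
  exists (fun y => f t y * expR (- 1))%R; split.
  - exact: measurable_funM.
  - by move=> y; rewrite mulr_ge0 ?expR_ge0.
  - move=> y; rewrite /q alpha0 eqxx expeRD EFinM; congr (_ * _).
    by apply/eqP; rewrite lneK_eq lee_fin.
pose C := ((1 + alpha)^-1)%:E * \int[lambda]_z (f t z `^ (1 + alpha))%:E.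
exists (fun y => expR (alpha^-1 * (f t y `^ alpha - 1)) * fine (expeR (- C)))%R.
have C0 : 0 <= C.
  rewrite mule_ge0 ?lee_fin ?invr_ge0 ?addr_ge0//.
  by apply: integral_ge0 => y _; rewrite lee_fin powR_ge0.
split.
- apply: measurable_funM => //; apply: measurableT_comp => //.
  apply: measurable_funM => //; apply: measurable_funB => //.
  exact: (measurableT_comp (measurable_powR alpha)).
- by move=> y; rewrite mulr_ge0 ?expR_ge0// fine_ge0// expeR_ge0.
- move=> y; rewrite /q (negbTE alpha0) -/C expeRD [RHS]EFinM fineK//.
  by move: C C0 => [r| |].
Qed.

Definition real_mod_density y := fine (mod_density lambda alpha f t y).

Let mod_density_real : exists k : chi -> R, [/\ measurable_fun setT k,
  (forall y, 0 <= k y)%R,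
  (forall y, mod_density lambda alpha f t y = (k y)%:E),
  (forall y, expeR (q lambda alpha f t y) = Q lambda alpha f t * (k y)%:E) &
  \int[lambda]_y (k y)%:E = 1].
Proof.
have [k [mk k0 kE]] := expeR_q_real.
have QE : Q lambda alpha f t = \int[lambda]_y (k y)%:E.
  by apply: eq_integral => y _; exact: kE.
have /andP[Q0 Qoo] := Qt.
have Qfin : Q lambda alpha f t \is a fin_num by rewrite ge0_fin_numE// ltW.
pose c := fine (Q lambda alpha f t).
have cE : Q lambda alpha f t = c%:E by rewrite fineK.
have c0 : (0 < c)%R by rewrite -lte_fin -cE.
exists (fun y => c^-1 * k y)%R; split.
- exact: measurable_funM.
- by move=> y; rewrite mulr_ge0// invr_ge0 ltW.
- by move=> y; rewrite /mod_density kE cE inver gt_eqF// -EFinM mulrC.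
- by move=> y; rewrite kE cE -EFinM mulrA divff ?mul1r// gt_eqF.
- under eq_integral do rewrite EFinM.
  rewrite ge0_integralZl_EFin//.
  + by rewrite -QE cE -EFinM mulVf// gt_eqF.
  + by move=> y _; rewrite lee_fin.
  + exact/measurable_EFinP.
  + by rewrite invr_ge0 ltW.
Qed.

Lemma mod_densityE y :
  mod_density lambda alpha f t y = (real_mod_density y)%:E.
Proof.
rewrite /real_mod_density.
by have [k [_ _ kE _ _]] := mod_density_real; rewrite kE.
Qed.

Lemma real_mod_density_ge0 y : (0 <= real_mod_density y)%R.
Proof.
have [k [_ k0 kE _ _]] := mod_density_real.
rewrite /real_mod_density kE; exact: k0.
Qed.

Lemma measurable_real_mod_density : measurable_fun setT real_mod_density.
Proof.
have [k [mk _ kE _ _]] := mod_density_real.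
rewrite (_ : real_mod_density = k)//.
by apply/funext => y; rewrite /real_mod_density kE.
Qed.

Lemma integral_real_mod_density : \int[lambda]_y (real_mod_density y)%:E = 1.
Proof.
have [k [_ _ kE _ <-]] := mod_density_real.
by apply: eq_integral => y _; rewrite /real_mod_density kE.
Qed.

Lemma expeR_q y : expeR (q lambda alpha f t y) =
  Q lambda alpha f t * (real_mod_density y)%:E.
Proof.
by have [k [_ _ kE qE _]] := mod_density_real; rewrite /real_mod_density kE qE.
Qed.

Lemma mod_density_nE n (x : n.-tuple chi) :
  mod_density_n lambda alpha f x t =
  (\prod_(i < n) real_mod_density (tnth x i))%:E.
Proof. by rewrite -prodEFin; apply: eq_bigr => i _; exact: mod_densityE. Qed.

(** This factorization makes the [R_posterior] an ordinary Bayes posterior, for the modified prior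
    and the modified densities. *)
Lemma expeR_qn n (x : n.-tuple chi) : expeR (qn lambda alpha f x t) =
  Qn lambda alpha f n t * mod_density_n lambda alpha f x t.
Proof.
rewrite mod_density_nE -prodEFin /qn /Qn.
move: (tnth x) => {}x; elim: n x => [|n IH] x.
  by rewrite !big_ord0 expeR0 mule1.
rewrite !big_ord_recl expeRD expeR_q expeS -!muleA; congr (_ * _).
by rewrite muleCA; congr (_ * _); exact: IH.
Qed.

End model.

(** * Negligible sets and the Borel-Cantelli argument *)

Section almost_sure_bounds.
Context d (R : realType) (Omega : measurableType d).
Variable P : probability Omega R.

(** The covers obtained for [e = 1 / (n + 1)] have an intersection of measure 0. The cover may be
    built from choices that depend on [e], as with the reference parameter [t0] in the final
    proof. *)
Lemma negligible_le_eps (E : set Omega) :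
  (forall e : R, (0 < e)%R ->
    exists B, [/\ measurable B, E `<=` B & P B <= e%:E]) ->
  P.-negligible E.
Proof.
move=> HE.
pose B n := sval (cid (HE (n.+1%:R^-1)%R ltac:(by rewrite invr_gt0))).
have BP n : [/\ measurable (B n), E `<=` B n & P (B n) <= (n.+1%:R^-1)%:E].
  by rewrite /B; case: cid.
have mB : measurable (\bigcap_n B n).
  by apply: bigcapT_measurable => n; have [] := BP n.
exists (\bigcap_n B n); split=> //; last first.
  by move=> w Ew n _; have [_ + _] := BP n; exact.
apply/eqP; rewrite eq_le measure_ge0 andbT; apply/lee_addgt0Pr => e e0.
rewrite add0e; have [n ne] : exists n, (n.+1%:R^-1 <= e)%R.
  exists (Num.bound (e^-1)); rewrite -[leRHS]invrK lef_pV2 ?posrE ?invr_gt0//.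
  rewrite (le_trans (ltW (archi_boundP _)))// ?ler_nat//.
  by rewrite invr_ge0 ltW.
have [mBn _ PB] := BP n.
rewrite (le_trans _ (le_trans PB _)) ?lee_fin//.
by apply: le_measure; [exact/mem_set|exact/mem_set|move=> w; exact].
Qed.

(** Markov's inequality bounds the probability of exceeding [expR (n * e)] by [expR (- n * e)], a
    summable sequence, and Borel-Cantelli concludes. *)
Lemma eventually_le_expR (Y : nat -> Omega -> \bar R) (e : R) : (0 < e)%R ->
  (forall n, (0 < n)%N -> measurable_fun setT (Y n)) ->
  (forall n w, (0 < n)%N -> 0 <= Y n w) ->
  (forall n, (0 < n)%N -> \int[P]_w Y n w <= 1) ->
  {ae P, forall w, \forall n \near \oo, Y n w <= (expR (n%:R * e))%:E}.
Proof.
move=> e0 mY Y0 EY.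
(* The index is shifted by one because the hypotheses on [Y n] hold only for [n > 0]. *)
pose F n := [set w | (expR (n.+1%:R * e))%:E <= Y n.+1 w].
have mF n : measurable (F n).
  rewrite -[X in measurable X]setTI.
  by apply: emeasurable_fun_c_infty => //; exact: mY.
pose x := expR (- e).
have x0 : (0 < x)%R by exact: expR_gt0.
have x1 : (x < 1)%R by rewrite /x expR_lt1 oppr_lt0.
have PF n : P (F n) <= (x ^+ n)%:E.
  have := le_integral_abse P measurableT (mY n.+1 isT) (expR_gt0 (n.+1%:R * e)).
  rewrite setTI; under eq_integral do rewrite gee0_abs ?Y0//.
  have -> : [set w | (expR (n.+1%:R * e))%:E <= `|Y n.+1 w|] = F n.
    by apply/seteqP; split => w /=; rewrite gee0_abs ?Y0.
  move=> /le_trans/(_ (EY n.+1 isT)).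
  rewrite -[X in X <= _]muleC -lee_pdivlMr ?expR_gt0// mul1e => /le_trans; apply.
  rewrite lee_fin -expRN -mulrN expRM_natl -/x exprS ler_piMl// ?ltW//.
  exact: exprn_gt0.
have sumF : \sum_(n <oo) P (F n) < +oo.
  apply: (@le_lt_trans _ _ (1 - x)^-1%:E); last exact: ltry.
  apply: lime_le; first by apply: is_cvg_nneseries => n _ _; exact: measure_ge0.
  apply: nearW => n.
  apply: (@le_trans _ _ (\sum_(0 <= i < n) (x ^+ i)%:E)); first exact: lee_sum.
  rewrite sumEFin lee_fin big_mkord.
  rewrite -[leRHS]mul1r ler_pdivlMr ?subr_gt0// mulrC.
  have -> : ((1 - x) * \sum_(i < n) x ^+ i = 1 - x ^+ n)%R.
    by rewrite -opprB mulNr -subrX1 opprB.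
  by rewrite gerBl exprn_ge0// ltW.
exists (lim_sup_set F); split.
- apply: bigcap_measurable; first by exists 0%N.
  by move=> n _; exact: bigcup_measurable.
- exact: lim_sup_set_cvg0.
- move=> w /= nw n _; apply: contrapT => nF; apply: nw.
  exists n.+1 => // k /=; case: k => // k nk.
  rewrite leNgt; apply/negP => lt; apply: nF; exists k => //.
  exact: ltW.
Qed.

End almost_sure_bounds.

(** * Likelihood ratios against the true density *)

Section mixture.
Context dO d (R : realType) (Omega : measurableType dO)
  (chi : measurableType d).
Variables (P : probability Omega R) (X : nat -> {RV P >-> chi}).
Variables (lambda : {measure set chi -> \bar R}).
Variables (G : probability chi R) (g : chi -> R).
Hypotheses (Xindep : mutually_independent X)
  (Xlaw : forall i B, measurable B -> distribution P (X i) B = G B)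
  (gG : is_density_of lambda G g).

Let mg : measurable_fun setT g. Proof. by have [] := gG. Qed.

Let g0 y : (0 <= g y)%R. Proof. by have [_ + _] := gG; exact. Qed.

Lemma integral_true_law (h : chi -> \bar R) :
  measurable_fun setT h -> (forall y, 0 <= h y) ->
  \int[G]_y h y = \int[lambda]_y ((g y)%:E * h y).
Proof.
move=> mh h0; rewrite -[LHS]mul1e -(integral_change_of_density (m := G)
  (mu := lambda) (phi := id) (U := g) (c := 1%R))//.
move=> B mB; have [_ _ GE] := gG.
transitivity (\int[lambda]_(y in B) (g y)%:E); last first.
  by rewrite mul1e; exact/esym/GE.
rewrite [RHS]integral_mkcond; apply: eq_integral => y _.
rewrite patchE indicE; case: (y \in B); first by rewrite mulr1.
by rewrite mulr0.
Qed.

Lemma integral_true_density : \int[lambda]_y (g y)%:E = 1.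
Proof. by have [_ _ <-//] := gG; rewrite probability_setT. Qed.

(** The zero set of [g] has [G]-measure 0, being the integral of [g] over it. A countable union over
    [i] then justifies dividing by all [g (X i)] at once. *)
Lemma true_density_gt0 : {ae P, forall w, forall i, (0 < g (X i w))%R}.
Proof.
have mgle : measurable [set y | (g y <= 0)%R].
  rewrite -[X in measurable X]setTI; exact: measurable_fun_le.
have N0 : G [set y | (g y <= 0)%R] = 0.
  have [_ _ ->//] := gG; apply: integral0_eq => y /= gy.
  by congr EFin; apply/eqP; rewrite eq_le gy g0.
apply: negligibleS (negligible_bigcup (F := fun i =>
  X i @^-1` [set y | (g y <= 0)%R]) _).
  move=> w /= /existsNP[i /negP]; rewrite -leNgt => gi.
  by exists i.
move=> i; apply/negligibleP.
  by rewrite -[X in measurable X]setTI; exact: measurable_funP.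
by rewrite -[LHS]/(distribution P (X i) _) Xlaw.
Qed.

Variables (T : choiceType) (D : set T) (s : T -> chi -> R).
Hypotheses (countD : countable D)
  (ms : forall t, D t -> measurable_fun setT (s t))
  (s0 : forall t y, D t -> (0 <= s t y)%R)
  (s1 : forall t, D t -> \int[lambda]_y (s t y)%:E = 1).

Let measurable_ratio t : D t -> measurable_fun setT (fun y => s t y / g y)%R.
Proof. by move=> Dt; apply: measurable_fun_divr => //; exact: ms. Qed.

Let ratio_ge0 t y : D t -> (0 <= s t y / g y)%R.
Proof. by move=> Dt; rewrite divr_ge0// s0. Qed.

Lemma measurable_likelihood_ratio n t : D t ->
  measurable_fun setT (fun w => \prod_(i < n) (s t (X i w) / g (X i w)))%R.
Proof.
move=> Dt; apply: measurable_prod => i _.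
exact: (measurableT_comp (measurable_ratio Dt)).
Qed.

(** By independence the expectation is the [n]-th power of the integral of [g * (s t / g)]. That
    integral is at most 1, and possibly smaller, since the integrand is 0 where [g] vanishes. *)
Lemma expectation_likelihood_ratio n t : D t ->
  \int[P]_w (\prod_(i < n) (s t (X i w) / g (X i w)))%:E <= 1.
Proof.
move=> Dt; pose e := fine (\int[G]_y (s t y / g y)%:E).
have int0 : 0 <= \int[G]_y (s t y / g y)%:E.
  by apply: integral_ge0 => y _; rewrite lee_fin ratio_ge0.
have int1 : \int[G]_y (s t y / g y)%:E <= 1.
  rewrite integral_true_law.
  - rewrite -(s1 Dt); apply: ge0_le_integral => //.
    + by move=> y _; rewrite mule_ge0 ?lee_fin ?ratio_ge0.
    + apply: emeasurable_funM; first exact/measurable_EFinP.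
      exact/measurable_EFinP/measurable_ratio.
    + exact/measurable_EFinP/ms.
    + move=> y _; rewrite -EFinM lee_fin.
      have [->|gy] := eqVneq (g y) 0%R; first by rewrite mul0r s0.
      by rewrite mulrCA divff// mulr1.
  - exact/measurable_EFinP/measurable_ratio.
  - by move=> y; rewrite lee_fin ratio_ge0.
have eE : \int[G]_y (s t y / g y)%:E = e%:E.
  by rewrite fineK// ge0_fin_numE// (le_lt_trans int1) ?ltry.
rewrite (expectation_prod Xindep Xlaw (h := fun _ y => (s t y / g y)%R)
  (e := fun=> e)).
- rewrite lee_fin prodr_const card_ord exprn_ile1// -lee_fin -eE//.
- by move=> _; exact: measurable_ratio.
- by move=> _ y; exact: ratio_ge0.
- by move=> _.
Qed.

Variable pr : nat -> T -> R.
Hypotheses (pr0 : forall n t, (0 < n)%N -> D t -> (0 <= pr n t)%R)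
  (pr1 : forall n, (0 < n)%N -> \esum_(t in D) (pr n t)%:E <= 1).

(** By Tonelli the expectation of the mixture is at most the total mass of [pr n], hence at most
    1. *)
Lemma mixture_likelihood_ratio (e : R) : (0 < e)%R ->
  {ae P, forall w, \forall n \near \oo,
    \esum_(t in D) ((pr n t)%:E *
      (\prod_(i < n) (s t (X i w) / g (X i w)))%:E) <= (expR (n%:R * e))%:E}.
Proof.
move=> e0; apply: eventually_le_expR => // [n n0|n w n0|n n0].
- apply: measurable_countable_esum => // t; last first.
    move=> w Dt; rewrite mule_ge0 ?lee_fin ?pr0// prodr_ge0// => i _.
    exact: ratio_ge0.
  move=> Dt; apply: measurable_funeM; apply/measurable_EFinP.
  exact: measurable_likelihood_ratio.
- apply: esum_ge0 => t Dt.
  by rewrite mule_ge0 ?lee_fin ?pr0// prodr_ge0// => i _; exact: ratio_ge0.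
- rewrite integral_countable_esum//.
  + apply: le_trans (pr1 n0); apply: le_esum => t Dt.
    rewrite ge0_integralZl_EFin ?pr0//.
    * rewrite -[leRHS]mule1 lee_wpmul2l ?lee_fin ?pr0//.
      exact: expectation_likelihood_ratio.
    * by move=> w _; rewrite lee_fin prodr_ge0// => i _; exact: ratio_ge0.
    * exact/measurable_EFinP/measurable_likelihood_ratio.
  + move=> t Dt; apply: measurable_funeM; apply/measurable_EFinP.
    exact: measurable_likelihood_ratio.
  + move=> t w Dt; rewrite mule_ge0 ?lee_fin ?pr0// prodr_ge0// => i _.
    exact: ratio_ge0.
Qed.

End mixture.

(** Each factor [s / g] is at least the exponential of minus the positive part of [log_ratio]. Where
    [s] vanishes that positive part is [+oo] and the exponential is 0, so a sum in the extended
    reals covers this case too. *)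
Lemma prod_likelihood_ratio_ge d (T : measurableType d) (R : realType)
    (g s : T -> R) (n : nat) (x : nat -> T) (b : R) :
  (forall y, 0 <= s y)%R -> (forall y, 0 <= g y)%R ->
  (forall i, 0 < g (x i))%R ->
  \sum_(i < n) maxe 0 (log_ratio g s (x i)) <= b%:E ->
  (expR (- b) <= \prod_(i < n) (s (x i) / g (x i)))%R.
Proof.
move=> s0 g0 gx le_b; rewrite -lee_fin -prodEFin.
apply: (@le_trans _ _ (expeR (- \sum_(i < n) maxe 0 (log_ratio g s (x i))))).
  by rewrite -[leLHS]/(expeR (- b%:E)) lee_expeR leeN2.
elim: n {le_b} => [|n IH]; first by rewrite !big_ord0 oppe0 expeR0.
rewrite !big_ord_recr/= oppeD; last first.
  apply: ge0_adde_def; rewrite inE ?le_max ?lexx// sume_ge0// => i _.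
  by rewrite le_max lexx.
rewrite expeRD lee_pmul ?expeR_ge0//.
rewrite log_ratioE//; case: ifPn => [_|sx].
  by rewrite gt_eqF// maxey /= lee_fin divr_ge0.
have sx0 : (0 < s (x n))%R by rewrite lt_neqAle eq_sym sx s0.
rewrite lne_EFin ?divr_gt0// -EFin_max /= lee_fin.
have -> : (s (x n) / g (x n) = expR (- ln (g (x n) / s (x n))))%R.
  by rewrite expRN lnK ?posrE ?divr_gt0// invf_div.
by rewrite ler_expR lerN2 le_max lexx orbT.
Qed.

Lemma measurable_fun_inve d (T : measurableType d) (R : realType)
    (b : T -> \bar R) : (forall w, 0 <= b w) ->
  measurable_fun setT b -> measurable_fun setT (fun w => (b w)^-1).
Proof.
move=> b0 mb.
(* At [+oo] the formula agrees with the inverse, since [fine +oo] is 0 and the power [-1] of 0 is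
   0. *)
rewrite (_ : (fun w => _) = fun w =>
    if b w == 0 then +oo else (powR (fine (b w)) (-1))%:E).
  apply: measurable_fun_ifT => //; first exact: measurable_fun_eqe.
  apply/measurable_EFinP; apply: (measurableT_comp (measurable_powR (-1))).
  exact: measurableT_comp.
apply/funext => w; move: (b w) (b0 w) => [r| |] //= r0.
- by rewrite inver eqe powR_inv1.
- by rewrite invey powR_inv1// invr0.
Qed.

(** * The modified prior and the posterior *)

Section posterior.
Context d (R : realType) (p : nat) (chi : measurableType d).
Variables (lambda : {measure set chi -> \bar R}) (alpha : R).
Variables (Theta : set (p.-tuple R)) (f : p.-tuple R -> chi -> R).
Variable pi : nat -> p.-tuple R -> R.
Hypotheses (alpha_ge0 : (0 <= alpha)%R) (Theta_countable : countable Theta)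
  (f_density : forall t, Theta t -> is_prob_density lambda (f t))
  (pi_prior : is_prior_sequence Theta pi)
  (Q_pos_fin : forall t, Theta t -> 0 < Q lambda alpha f t < +oo).
Variable n : nat.
Hypothesis n0 : (0 < n)%N.
Hypothesis M_pos_fin : 0 < Mn lambda alpha Theta f pi n < +oo.

Definition real_mod_prior t := fine (mod_prior lambda alpha Theta f pi n t).

Let m := fine (Mn lambda alpha Theta f pi n).

Let m_gt0 : (0 < m)%R.
Proof. by rewrite fine_gt0. Qed.

Let mE : Mn lambda alpha Theta f pi n = m%:E.
Proof.
by case/andP: M_pos_fin => M0 Moo; rewrite fineK// ge0_fin_numE// ltW.
Qed.

Let pi_ge0 t : Theta t -> (0 <= pi n t)%R.
Proof. exact: (pi_prior n0).1. Qed.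

Let Qn_real t : Theta t ->
  exists2 a, (0 < a)%R & Qn lambda alpha f n t = a%:E.
Proof.
move=> /Q_pos_fin /andP[Q0 Qoo].
have QE : Q lambda alpha f t = (fine (Q lambda alpha f t))%:E.
  by rewrite fineK// ge0_fin_numE// ltW.
exists (fine (Q lambda alpha f t) ^+ n)%R.
  by rewrite exprn_gt0// -lte_fin -QE.
by rewrite /Qn QE -EFin_expe.
Qed.

Let mod_prior_real t : Theta t -> exists r, [/\ (0 <= r)%R,
  mod_prior lambda alpha Theta f pi n t = r%:E &
  Qn lambda alpha f n t * (pi n t)%:E = (m * r)%:E].
Proof.
move=> Dt; have [a a0 QnE] := Qn_real Dt.
exists (a * pi n t / m)%R; split.
- by rewrite divr_ge0 ?mulr_ge0 ?pi_ge0 ?ltW.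
- by rewrite /mod_prior QnE mE inver gt_eqF.
- by rewrite QnE -EFinM mulrCA divff ?mulr1// gt_eqF.
Qed.

Lemma mod_priorE t : Theta t ->
  mod_prior lambda alpha Theta f pi n t = (real_mod_prior t)%:E.
Proof. by move=> /mod_prior_real[r [_ rE _]]; rewrite /real_mod_prior rE. Qed.

Lemma real_mod_prior_ge0 t : Theta t -> (0 <= real_mod_prior t)%R.
Proof. by move=> /mod_prior_real[r [? rE _]]; rewrite /real_mod_prior rE. Qed.

Let Qn_pi t : Theta t ->
  Qn lambda alpha f n t * (pi n t)%:E = m%:E * (real_mod_prior t)%:E.
Proof. by move=> /mod_prior_real[r [_ rE ->]]; rewrite /real_mod_prior rE. Qed.

Lemma esum_real_mod_prior : \esum_(t in Theta) (real_mod_prior t)%:E <= 1.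
Proof.
rewrite -(@lee_pmul2l _ m%:E)// mule1 -countable_esumZl//; last 2 first.
- exact: ltW.
- by move=> t Dt; rewrite lee_fin real_mod_prior_ge0.
by rewrite -[leRHS]mE; apply: le_esum => t Dt; rewrite -Qn_pi.
Qed.

Let likelihood (x : n.-tuple chi) t :=
  (real_mod_prior t)%:E * mod_density_n lambda alpha f x t.

Let likelihood_ge0 x t : Theta t -> 0 <= likelihood x t.
Proof.
move=> Dt; rewrite mule_ge0 ?lee_fin ?real_mod_prior_ge0//.
rewrite (mod_density_nE alpha_ge0 (f_density Dt) (Q_pos_fin Dt)) lee_fin.
apply: prodr_ge0 => i _; apply: real_mod_density_ge0 => //.
- exact: f_density.
- exact: Q_pos_fin.
Qed.

(** The normalizing constant [m] appears in every weight of the posterior and cancels in the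
    quotient. *)
Let weight x t : Theta t ->
  expeR (qn lambda alpha f x t) * (pi n t)%:E = m%:E * likelihood x t.
Proof.
move=> Dt; rewrite (expeR_qn alpha_ge0 (f_density Dt) (Q_pos_fin Dt)).
by rewrite muleAC Qn_pi// muleA.
Qed.

Let esum_weight x (A : set (p.-tuple R)) : A `<=` Theta ->
  \esum_(t in A) (expeR (qn lambda alpha f x t) * (pi n t)%:E) =
  m%:E * \esum_(t in A) likelihood x t.
Proof.
move=> AT; rewrite -countable_esumZl//.
- by apply: eq_esum => t /AT; exact: weight.
- exact: (sub_countable (subset_card_le AT)).
- exact: ltW.
- by move=> t /AT; exact: likelihood_ge0.
Qed.

Lemma le_R_posterior (c : R) (x : n.-tuple chi) (A : set (p.-tuple R)) :
  A `<=` Theta -> 0 < (\esum_(t in Theta) likelihood x t) < +oo ->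
  c%:E * (\esum_(t in Theta) likelihood x t) <=
    \esum_(t in A) likelihood x t ->
  c%:E <= R_posterior lambda alpha Theta f pi A x.
Proof.
move=> AT; rewrite /R_posterior !esum_weight//.
case: (\esum_(t in Theta) likelihood x t) => [r| |]; rewrite ?ltxx ?andbF//.
rewrite lte_fin ltry andbT => r0 H.
rewrite -EFinM inver gt_eqF ?mulr_gt0// lee_pdivlMr ?mulr_gt0//.
by rewrite EFinM muleCA lee_pmul2l.
Qed.

(** Exponential smallness only says that [P] takes the value 0 on a limsup set. Turning this into an
    almost-everywhere statement requires the set to be measurable. *)
Lemma measurable_R_posterior dO (Omega : measurableType dO)
    (P : probability Omega R) (X : nat -> {RV P >-> chi})
    (A : set (p.-tuple R)) : A `<=` Theta ->
  measurable_fun setT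
    (fun w => R_posterior lambda alpha Theta f pi A (sample X n w)).
Proof.
have msum B : B `<=` Theta -> measurable_fun setT (fun w =>
    \esum_(t in B) (expeR (qn lambda alpha f (sample X n w) t) * (pi n t)%:E)).
  move=> BT; apply: measurable_countable_esum => //.
  - exact: (sub_countable (subset_card_le BT)).
  - move=> t /BT Dt; have [a _ QnE] := Qn_real Dt.
    under eq_fun do rewrite (expeR_qn alpha_ge0 (f_density Dt) (Q_pos_fin Dt))
      (mod_density_nE alpha_ge0 (f_density Dt) (Q_pos_fin Dt)) QnE -!EFinM.
    apply/measurable_EFinP; apply: measurable_funM => //.
    apply: measurable_funM => //; apply: measurable_prod => i _.
    apply: measurableT_comp.
      apply: measurable_real_mod_density => //.
      + exact: f_density.
      + exact: Q_pos_fin.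
    under eq_fun do rewrite tnth_mktuple.
    exact: measurable_funP.
  - move=> t w /BT Dt; rewrite weight// mule_ge0 ?likelihood_ge0//.
    by rewrite lee_fin ltW.
move=> AT; apply: emeasurable_funM; first exact: msum.
apply: measurable_fun_inve; last exact: msum.
move=> w; rewrite esum_ge0// => t Dt.
by rewrite weight// mule_ge0 ?likelihood_ge0// lee_fin ltW.
Qed.

End posterior.

(** * Localization of the approximate maximizer *)

(** The deterministic part of the argument, for one sample. If [t1] were outside [A], the posterior
    of the complement would be at least the term of [t1] over the total. With [G] the product of the
    [g (x_i)], that term exceeds [G * expR (- 3 n eps)] and the total is at most [G * expR (n eps)].
    The ratio is at least [expR (- 4 n eps) >= expR (- n r)], a contradiction. *)
Lemma estimator_mem d (R : realType) (p : nat) (chi : measurableType d)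
    (lambda : {measure set chi -> \bar R}) (alpha : R)
    (Theta A : set (p.-tuple R)) (f : p.-tuple R -> chi -> R)
    (pi : nat -> p.-tuple R -> R) (g : chi -> R) (n : nat) (x : n.-tuple chi)
    (eps delta r : R) (t0 t1 : p.-tuple R)
    (L := fun t => mod_prior lambda alpha Theta f pi n t *
                   mod_density_n lambda alpha f x t)
    (ratio := fun t => (\prod_(i < n)
      (real_mod_density lambda alpha f t (tnth x i) / g (tnth x i)))%R) :
  (0 <= alpha)%R -> countable Theta ->
  (forall t, Theta t -> is_prob_density lambda (f t)) ->
  is_prior_sequence Theta pi ->
  (forall t, Theta t -> 0 < Q lambda alpha f t < +oo) ->
  (0 < n)%N -> 0 < Mn lambda alpha Theta f pi n < +oo ->
  (forall i, 0 < g (tnth x i))%R ->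
  Theta t0 -> Theta t1 -> (delta <= eps)%R -> (4 * eps <= r)%R ->
  \esum_(t in Theta) ((real_mod_prior lambda alpha Theta f pi n t)%:E *
    (ratio t)%:E) <= (expR (n%:R * eps))%:E ->
  (expR (- (n%:R * eps)))%:E <= mod_prior lambda alpha Theta f pi n t0 ->
  (expR (- (n%:R * eps)) <= ratio t0)%R ->
  ereal_sup [set L t | t in Theta] * (expR (- (n%:R * delta)))%:E < L t1 ->
  R_posterior lambda alpha Theta f pi (Theta `\` A) x <
    (expR (- (n%:R * r)))%:E ->
  A t1.
Proof.
move=> alpha0 countT fT piT QT n0 M0 gx Tt0 Tt1 delta_eps eps_r mix prior0 ratio0.
move=> t1_max post; apply: contrapT => At1.
pose pr := real_mod_prior lambda alpha Theta f pi n.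
have prE t : Theta t -> mod_prior lambda alpha Theta f pi n t = (pr t)%:E.
  by move=> Tt; rewrite (mod_priorE piT QT n0 M0 Tt).
have pr0 t : Theta t -> (0 <= pr t)%R.
  by move=> Tt; exact: (real_mod_prior_ge0 piT QT n0 M0 Tt).
pose G := (\prod_(i < n) g (tnth x i))%R.
have G0 : (0 < G)%R by exact: prodr_gt0.
have ratio_ge0 t : Theta t -> (0 <= ratio t)%R.
  move=> Tt; apply: prodr_ge0 => i _; rewrite divr_ge0 ?(ltW (gx i))//.
  exact: (real_mod_density_ge0 alpha0 (fT _ Tt) (QT _ Tt)).
have densE t : Theta t -> mod_density_n lambda alpha f x t = (G * ratio t)%:E.
  move=> Tt; rewrite (mod_density_nE alpha0 (fT _ Tt) (QT _ Tt)) -big_split/=.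
  congr EFin; apply: eq_bigr => i _.
  by rewrite mulrCA divff ?mulr1// gt_eqF.
have LE t : Theta t -> L t = G%:E * ((pr t)%:E * (ratio t)%:E).
  by move=> Tt; rewrite /L prE// densE// EFinM muleCA.
have L0 t : Theta t -> 0 <= L t.
  by move=> Tt; rewrite LE// !mule_ge0 ?lee_fin ?pr0 ?ratio_ge0 ?ltW.
have LprE t : Theta t -> (pr t)%:E * mod_density_n lambda alpha f x t = L t.
  by move=> Tt; rewrite /L prE.
pose S B := \esum_(t in B) ((pr t)%:E * mod_density_n lambda alpha f x t).
have St1 B : B `<=` Theta -> B t1 -> L t1 <= S B.
  move=> BT Bt1; apply: esum_ge; exists [set t1]; first by split => // _ ->.
  by rewrite fsbig_set1 LprE.
have STheta : S Theta <= (G * expR (n%:R * eps))%:E.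
  rewrite EFinM; apply: le_trans (lee_wpmul2l _ mix); last by rewrite lee_fin ltW.
  rewrite -countable_esumZl ?(ltW G0)//.
    by apply: le_esum => t Tt; rewrite LprE// LE.
  by move=> t Tt; rewrite mule_ge0 ?lee_fin ?pr0 ?ratio_ge0.
(* The three factors [expR (- n eps)] come from the prior of [t0], from its likelihood ratio, and
   from the tolerance [delta] of the estimator. *)
have t1_large : (G * expR (- (3 * (n%:R * eps))))%:E < L t1.
  apply: le_lt_trans t1_max.
  apply: (@le_trans _ _ (L t0 * (expR (- (n%:R * delta)))%:E)); last first.
    apply: lee_wpmul2r; first by rewrite lee_fin expR_ge0.
    by apply: ereal_sup_ubound; exists t0.
  rewrite LE// -!EFinM lee_fin -mulrA ler_pM2l//.
  have -> : (- (3 * (n%:R * eps)) =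
    - (n%:R * eps) + - (n%:R * eps) + - (n%:R * eps))%R by lra.
  rewrite !expRD; apply: ler_pM; rewrite ?mulr_ge0 ?expR_ge0//.
    apply: ler_pM; rewrite ?expR_ge0//.
    by rewrite -lee_fin -prE.
  by rewrite ler_expR lerN2 ler_wpM2l.
have : (expR (- (n%:R * r)))%:E <=
    R_posterior lambda alpha Theta f pi (Theta `\` A) x.
  apply: (le_R_posterior alpha0 countT fT piT QT n0 M0).
  - by move=> t [].
  - apply/andP; split.
      apply: lt_le_trans (St1 Theta _ _) => //; apply: le_lt_trans t1_large.
      by rewrite lee_fin mulr_ge0 ?expR_ge0 ?ltW.
    exact: le_lt_trans STheta (ltry _).
  - apply: (@le_trans _ _ (L t1)); last by apply: St1 => // t [].
    apply: le_trans (ltW t1_large).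
    apply: le_trans (lee_wpmul2l _ STheta) _; first by rewrite lee_fin expR_ge0.
    rewrite -EFinM lee_fin mulrCA ler_pM2l// -expRD ler_expR.
    have : (n%:R * (4 * eps) <= n%:R * r)%R by rewrite ler_wpM2l.
    lra.
by rewrite leNgt post.
Qed.

(** At rate [eps / 2], the bound on the lower limit gives [expR (n eps / 2) * u n >= 1 / 2]
    eventually, where [1 / 2] is a constant strictly below 1. The other half of the rate absorbs it
    once [n >= 2 / eps]. *)
Lemma eventually_prior_ge (R : realType) (u : nat -> \bar R) (eps : R) :
  (0 < eps)%R ->
  1 <= limn_einf (fun n => (expR (n%:R * (eps / 2)))%:E * u n) ->
  \forall n \near \oo, (expR (- (n%:R * eps)))%:E <= u n.
Proof.
move=> eps0; set v := fun n => _; rewrite limn_einf_lim => v1.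
have v2 : \forall n \near \oo, (2^-1)%:E <= einfs v n.
  apply: lte_lim; [exact: nondecreasing_einfs|exact: is_cvg_einfs|].
  by apply: lt_le_trans v1; rewrite lte_fin; lra.
near=> n.
have : (2^-1)%:E <= v n.
  apply: (@le_trans _ _ (einfs v n)); first by near: n.
  by apply: ereal_inf_lbound; exists n => /=.
rewrite /v -lee_pdivrMl ?expR_gt0//; apply: le_trans.
rewrite -EFinM lee_fin -expRN.
have -> : (- (n%:R * eps) = - (n%:R * (eps / 2)) + - (n%:R * (eps / 2)))%R.
  by lra.
rewrite expRD ler_wpM2l ?expR_ge0// expRN lef_pV2 ?posrE ?expR_gt0//.
apply: le_trans (expR_ge1Dx _).
have : (2 / eps <= n%:R)%R by near: n; exact: nbhs_infty_ger.
rewrite ler_pdivrMr// => ?; lra.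
Unshelve. all: by end_near. Qed.

Theorem theorem4p4 (R : realType) (dO d : measure_display)
  (Omega : measurableType dO) (chi : measurableType d)
  (P : probability Omega R)
  (lambda : {sigma_finite_measure set chi -> \bar R})
  (* the i.i.d. data, with law G of density g *)
  (X : nat -> {RV P >-> chi}) (G : probability chi R) (g : chi -> R)
  (Xindep : mutually_independent X)
  (Xlaw : forall i B, measurable B -> distribution P (X i) B = G B)
  (gG : is_density_of lambda G g)
  (* the model and the priors *)
  (p : nat) (Theta : set (p.-tuple R)) (Theta_countable : countable Theta)
  (f : p.-tuple R -> chi -> R)
  (f_density : forall t, Theta t -> is_prob_density lambda (f t))
  (pi : nat -> p.-tuple R -> R) (pi_prior : is_prior_sequence Theta pi)
  (alpha : R) (alpha_ge0 : (0 <= alpha)%R)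
  (Q_pos_fin : forall t, Theta t -> 0 < Q lambda alpha f t < +oo)
  (M_pos_fin : forall n, (0 < n)%N -> 0 < Mn lambda alpha Theta f pi n < +oo)
  (mod_prior_liminf : forall r : R, (0 < r)%R -> forall t, Theta t ->
     1 <= limn_einf (fun n =>
       (expR (n%:R * r))%:E * mod_prior lambda alpha Theta f pi n t))
  (pi_dense : information_dense lambda alpha Theta f pi g)
  (A : nat -> set (p.-tuple R))
  (A_meas : forall n, measurable (A n)) (A_sub : forall n, A n `<=` Theta)
  (A_small : exponentially_small_as P (fun n w =>
     R_posterior lambda alpha Theta f pi (Theta `\` A n) (sample X n w)))
  (that : forall n : nat, n.-tuple chi -> p.-tuple R)
  (that_amax : approx_max_estimator X lambda alpha Theta f pi that) :
  {ae P, forall w, \forall n \near \oo, A n (that n (sample X n w))}.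
Proof.
have [r r0 post_limsup] := A_small.
have [that_Theta [delta delta0 that_max]] := that_amax.
pose s := real_mod_density lambda alpha f.
pose pr n := real_mod_prior lambda alpha Theta f pi n.
have ms t : Theta t -> measurable_fun setT (s t).
  move=> Tt.
  exact: (measurable_real_mod_density alpha_ge0 (f_density _ Tt) (Q_pos_fin _ Tt)).
have s0 t y : Theta t -> (0 <= s t y)%R.
  move=> Tt.
  exact: (real_mod_density_ge0 alpha_ge0 (f_density _ Tt) (Q_pos_fin _ Tt) _).
have s1 t : Theta t -> \int[lambda]_y (s t y)%:E = 1.
  move=> Tt.
  exact: (integral_real_mod_density alpha_ge0 (f_density _ Tt) (Q_pos_fin _ Tt)).
have pr0 n t : (0 < n)%N -> Theta t -> (0 <= pr n t)%R.
  move=> n0 Tt.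
  exact: (real_mod_prior_ge0 pi_prior Q_pos_fin n0 (M_pos_fin _ n0) Tt).
have pr1 n : (0 < n)%N -> \esum_(t in Theta) (pr n t)%:E <= 1.
  move=> n0; exact: (esum_real_mod_prior Theta_countable pi_prior
    Q_pos_fin n0 (M_pos_fin _ n0)).
(* Chosen so that [4 * eps <= r], as [estimator_mem] requires. *)
pose eps := (r / 8)%R.
have eps0 : (0 < eps)%R by rewrite divr_gt0.
apply: negligible_le_eps => e e0.
(* The bound [eta <= 1] is for [KLD_log_ratio_pos]; [4 * eta <= eps * e] makes the maximal
   inequality at level [eps] yield probability at most [e]. *)
pose eta := Num.min 1%R (eps * e / 4)%R.
have eta01 : (0 < eta <= 1)%R.
  by rewrite lt_min ge_min lexx ltr01 /= andbT divr_gt0// mulr_gt0.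
(* A set of positive [nu]-measure is nonempty. *)
have [t0 Tt0 Kt0] : exists2 t, Theta t &
    KLD lambda (fun y => (g y)%:E) (fun y => (s t y)%:E) < (eta ^+ 2)%:E.
  have [nu [_ _ nu_pos]] := pi_dense.
  apply: contrapT => /forall2NP no_t.
  have := nu_pos (eta ^+ 2)%R; rewrite exprn_gt0; last by case/andP: eta01.
  move=> /(_ isT); rewrite (_ : [set _ | _] = set0) ?measure0 ?ltxx//.
  apply/seteqP; split => // t [Tt Kt]; have [//|] := no_t t; apply.
  rewrite (_ : (fun y => (s t y)%:E) = mod_density lambda alpha f t)//.
  apply/funext => y; apply/esym.
  exact: (mod_densityE alpha_ge0 (f_density _ Tt) (Q_pos_fin _ Tt)).
have [mg g0 _] := gG.
pose h y := maxe 0 (log_ratio g (s t0) y).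
have mh : measurable_fun setT h.
  apply: measurable_maxe => //; apply: measurable_log_ratio => //.
  - exact: ms.
  - by move=> y; exact: s0.
have h0 y : 0 <= h y by rewrite le_max lexx.
have inth : \int[G]_y h y <= (eps * e)%:E.
  rewrite (integral_true_law gG)//; apply: (@le_trans _ _ (4 * eta)%:E).
    apply: (KLD_log_ratio_pos mg g0 (ms _ Tt0) (fun y => s0 _ y Tt0) eta01) => //.
    - exact: (integral_true_density gG).
    - by rewrite s1.
  by rewrite lee_fin mulrC -ler_pdivlMr// ge_min lexx orbT.
(* Off [B], the likelihood ratio of [t0] is at least [expR (- n eps)] for every [n > 0] at which all
   [g (X i)] are positive. [B] is the only exceptional event that is small without being
   negligible. *)
pose B := \bigcup_(n in [set n | (0 < n)%N])
  [set w | (n%:R * eps)%:E < \sum_(i < n) h (X i w)].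
have mB : measurable B.
  apply: bigcup_measurable => n _; rewrite -[X in measurable X]setTI.
  apply: emeasurable_fun_o_infty => //; apply: emeasurable_sum => i.
  by apply: measurableT_comp => //; exact: measurable_funP.
have PB : P B <= e%:E.
  rewrite -(@lee_pmul2l _ eps%:E)// -EFinM; apply: le_trans inth.
  exact: (maximal_inequality Xindep Xlaw mh h0 eps0).
have mixture := mixture_likelihood_ratio Xindep Xlaw gG Theta_countable ms s0 s1
  pr0 pr1 eps0.
have gpos := true_density_gt0 Xlaw gG.
pose F n := [set w | (expR (- (n%:R * r)))%:E <=
  R_posterior lambda alpha Theta f pi (Theta `\` A n) (sample X n w)].
(* Nothing is assumed about [pi 0], but the posterior of the empty sample does
   not depend on [w]. *)
have mF n : measurable (F n).
  case: n => [|n].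
    rewrite (_ : F 0%N = [set _ | (expR (- (0%:R * r)))%:E <=
      R_posterior lambda alpha Theta f pi (Theta `\` A 0%N) [tuple]]).
      have [Hle|Hle] := boolP ((expR (- (0%:R * r)))%:E <=
        R_posterior lambda alpha Theta f pi (Theta `\` A 0%N) [tuple]).
        by rewrite (_ : [set _ | _] = setT)//; apply/seteqP.
      rewrite (_ : [set _ | _] = set0)//.
      by apply/seteqP; split => // w; rewrite (negbTE Hle).
    by apply/seteqP; split => w; rewrite /F /= (tuple0 (sample X 0 w)).
  rewrite -[X in measurable X]setTI; apply: emeasurable_fun_c_infty => //.
  apply: (measurable_R_posterior alpha_ge0 Theta_countable f_density pi_prior
    Q_pos_fin (ltn0Sn n) (M_pos_fin _ (ltn0Sn n))).
  by move=> t [].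
have post : {ae P, forall w, \forall n \near \oo,
    R_posterior lambda alpha Theta f pi (Theta `\` A n) (sample X n w) <
    (expR (- (n%:R * r)))%:E}.
  exists (lim_sup_set F); split=> //.
    apply: bigcap_measurable; first by exists 0%N.
    by move=> n _; exact: bigcup_measurable.
  move=> w /= nw n _; apply: contrapT => nF; apply: nw; exists n => // k /= nk.
  by rewrite ltNge; apply/negP => Fk; apply: nF; exists k.
have that_max_all : {ae P, forall w, forall n, (0 < n)%N ->
    ereal_sup [set mod_prior lambda alpha Theta f pi n t *
      mod_density_n lambda alpha f (sample X n w) t | t in Theta] *
      (expR (- (n%:R * delta n)))%:E <
    mod_prior lambda alpha Theta f pi n (that n (sample X n w)) *
      mod_density_n lambda alpha f (sample X n w) (that n (sample X n w))}.
  apply/ae_foralln => -[|n]; first by apply: aeW.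
  by apply: filterS (that_max n.+1 isT).
have [N [mN PN0 subN]] :=
  filterI (filterI mixture gpos) (filterI post that_max_all).
exists (B `|` N); split.
- exact: measurableU.
- move=> w /= bad; apply: contrapT => /not_orP[nB nN]; apply: bad.
  have /contrapT /= := fun nC => nN (subN w nC).
  move=> [[mixw gw] [postw maxw]].
  have prior_ge : \forall n \near \oo, (expR (- (n%:R * eps)))%:E <=
      mod_prior lambda alpha Theta f pi n t0.
    apply: eventually_prior_ge => //; apply: mod_prior_liminf => //.
    by rewrite divr_gt0.
  have delta_le : \forall n \near \oo, (delta n <= eps)%R.
    by apply: cvgr_le delta0 _ _.
  near=> n.
  have n0 : (0 < n)%N by near: n; exact: nbhs_infty_gt.
  apply: (@estimator_mem _ _ _ _ lambda alpha Theta (A n) f pi g n (sample X n w)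
    eps (delta n) r t0) => //.
  - exact: M_pos_fin.
  - by move=> i; rewrite tnth_mktuple.
  - exact: (that_Theta n n0).2.
  - by near: n.
  - by rewrite /eps; lra.
  - under eq_esum do under eq_bigr do rewrite tnth_mktuple.
    by near: n.
  - by near: n.
  - under eq_bigr do rewrite tnth_mktuple.
    apply: (@prod_likelihood_ratio_ge _ _ _ g (s t0) n (fun i => X i w)) => //.
    + by move=> y; exact: s0.
    + rewrite leNgt; apply/negP => lt; apply: nB; exists n => //.
  - exact: maxw.
  - by near: n.
- have PBN : P (B `|` N) <= P B + P N by exact: measureU2.
  by apply: le_trans PBN _; have -> : P N = 0 := PN0; rewrite adde0.
Unshelve. all: by end_near. Qed.
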